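(* Let $d\ge 2$ be an integer. There exist positive constants $C_1$ and $C_2$ depending on $d$ only such that the following holds. Let $n\ge 1$ be an integer, let $K$ be a convex body in $\mathbb R^d$ with $K\subseteq B_d$, let $f$ be a probability density (with respect to Lebesgue measure) supported on $K$ with $f\le M$ almost everywhere for some positive number $M$, let $X_1,\dots,X_n$ be i.i.d. random points with density $f$, and let $\hat K_n$ be their convex hull. Then $$\mathbb P_f\left[n\left(d_f(K,\hat K_n)-C_1(M+1)n^{-2/(d+1)}\right)>x\right]\le C_2e^{-x},\qquad \forall x\ge 0.$$
   Context: A convex body in $\mathbb R^d$ is a compact convex set with nonempty interior. $B_d$ is the closed unit Euclidean ball of $\mathbb R^d$ centered at $0$. $\mathbb P_f$ denotes the joint law of $X_1,\dots,X_n$ when they are i.i.d. with density $f$. That $f$ is supported on $K$ means that $f=0$ outside $K$. The weighted missing volume is $d_f(K,\hat K_n)=\int_{K\setminus\hat K_n}f(x)\,dx$. *)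

(* Defs.v *)
From HB Require Import structures.
From mathcomp Require Import all_boot all_order all_algebra.
From mathcomp Require Import all_classical all_reals all_analysis.

Set Implicit Arguments.
Unset Strict Implicit.
Unset Printing Implicit Defensive.

Import Order.TTheory GRing.Theory Num.Theory.
Import numFieldNormedType.Exports.

Local Open Scope classical_set_scope.
Local Open Scope ring_scope.

Section measurable_rV.
Context {d} {T : measurableType d} (n : nat).

Let coors (i : 'I_n) (v : 'rV[T]_n) : T := v ord0 i.

Let rV_set0 : g_sigma_preimage coors set0.
Proof. exact: sigma_algebra0. Qed.

Let rV_setC A : g_sigma_preimage coors A -> g_sigma_preimage coors (~` A).
Proof. exact: sigma_algebraC. Qed.

Let rV_bigcup (F : _^nat) : (forall i, g_sigma_preimage coors (F i)) ->
  g_sigma_preimage coors (\bigcup_i (F i)).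
Proof. exact: sigma_algebra_bigcup. Qed.

(* The product sigma-algebra, as the library does for [n.-tuple T]; for
   [T := R] it is the Borel sigma-algebra (see [open_measurable_rV]). *)
HB.instance Definition _ := @isMeasurable.Build (measure_tuple_display d)
  'rV[T]_n (g_sigma_preimage coors) rV_set0 rV_setC rV_bigcup.

End measurable_rV.

Lemma measurable_coord d (T : measurableType d) n (i : 'I_n) :
  measurable_fun [set: 'rV[T]_n] (fun v => v ord0 i).
Proof.
move=> _ Y mY; rewrite setTI; apply: sub_sigma_algebra => /=.
rewrite -bigcup_seq/=; exists i => /=; first by rewrite mem_index_enum.
by exists Y => //; rewrite setTI.
Qed.

Lemma measurable_fun_coordP d1 d2 (T1 : measurableType d1)
    (T2 : measurableType d2) n (f : T1 -> 'rV[T2]_n) :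
  measurable_fun [set: T1] f <->
  forall i, measurable_fun [set: T1] (fun x => f x ord0 i).
Proof.
split=> [mf i|mf].
  exact: (measurableT_comp (@measurable_coord _ T2 n i) mf).
move=> _ A mA; rewrite setTI.
suff: (@measurable _ 'rV[T2]_n) `<=` [set B | measurable (f @^-1` B)] by apply.
apply: smallest_sub.
  split => /=; first by rewrite preimage_set0.
    by move=> B mB; rewrite setTD preimage_setC; exact: measurableC.
  by move=> F mF; rewrite preimage_bigcup; exact: bigcup_measurable.
rewrite -bigcup_seq => B [i _ [C mC <-]] /=; rewrite setTI.
by have := mf i measurableT _ mC; rewrite setTI.
Qed.

Definition rV_cons (T : Type) n (p : T * 'rV[T]_n) : 'rV[T]_n.+1 :=
  row_mx (const_mx p.1 : 'rV_1) p.2.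

Lemma rV_cons0 (T : Type) n (p : T * 'rV[T]_n) : rV_cons p ord0 ord0 = p.1.
Proof. by rewrite mxE; case: splitP => // k _; rewrite mxE. Qed.

Lemma rV_consS (T : Type) n (p : T * 'rV[T]_n) (i : 'I_n) :
  rV_cons p ord0 (lift ord0 i) = p.2 ord0 i.
Proof.
rewrite mxE; case: splitP => [k|k]; first by rewrite ord1.
by rewrite /= /bump/= !add1n => -[ik]; congr (p.2 _ _); exact/val_inj.
Qed.

Lemma measurable_rV_cons d (T : measurableType d) n :
  measurable_fun [set: T * 'rV[T]_n] (@rV_cons T n).
Proof.
apply/measurable_fun_coordP => i.
have [j ->|->] := unliftP ord0 i.
  under eq_fun do rewrite rV_consS.
  exact: (measurableT_comp (@measurable_coord _ T n j) measurable_snd).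
under eq_fun do rewrite rV_cons0.
exact: measurable_fst.
Qed.

(* d-dimensional Lebesgue measure on the Borel sets of R^d, by iterated
   products; [lebesgue_rV_box] gives its value on boxes. *)
Fixpoint lebesgue_rV (R : realType) (n : nat) : set 'rV[R]_n -> \bar R :=
  if n is m.+1 return set 'rV[R]_n -> \bar R then
    pushforward (@lebesgue_measure R \x @lebesgue_rV R m)%E (@rV_cons R m)
  else @dirac _ 'rV[R]_0 (0 : 'rV[R]_0) R.
Arguments lebesgue_rV {R} n _.

Lemma measurable_box (R : realType) n (A : 'I_n -> set R) :
  (forall i, measurable (A i)) ->
  measurable [set v : 'rV[R]_n | forall i, A i (v ord0 i)].
Proof.
move=> mA; rewrite (_ : mkset _ = \bigcap_(i in [set` index_enum 'I_n])
    ((fun v : 'rV[R]_n => v ord0 i) @^-1` A i)).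
  rewrite bigcap_seq; apply: bigsetI_measurable => i _.
  rewrite -[X in measurable X]setTI.
  exact: (@measurable_coord _ R n i).
apply/seteqP; split => v /= Av; first by move=> i _; exact: Av.
by move=> i; apply: Av; rewrite /= mem_index_enum.
Qed.

Lemma rV_cons_box (T : Type) n (A : 'I_n.+1 -> set T) :
  @rV_cons T n @^-1` [set v : 'rV[T]_n.+1 | forall i, A i (v ord0 i)] =
  A ord0 `*` [set v : 'rV[T]_n | forall i, A (lift ord0 i) (v ord0 i)].
Proof.
apply/seteqP; split => p /= Ap.
  split; first by have := Ap ord0; rewrite rV_cons0.
  by move=> i /=; have := Ap (lift ord0 i); rewrite rV_consS.
move=> i; have [j ->|->] := unliftP ord0 i.
  by rewrite rV_consS; apply: Ap.2.
by rewrite rV_cons0; apply: Ap.1.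
Qed.

Lemma lebesgue_rV_sigma_finite_measure (R : realType) n :
  exists mu : {sigma_finite_measure set 'rV[R]_n -> \bar R},
    lebesgue_rV n = mu.
Proof.
elim: n => [|n [mu muE]].
  by exists (@dirac _ 'rV[R]_0 (0 : 'rV[R]_0) R).
pose nu : {measure set (measurableTypeR R * 'rV[R]_n)%type -> \bar R} :=
  (@lebesgue_measure R \x mu)%E.
have leE : lebesgue_rV n.+1 = pushforward nu (@rV_cons R n).
  by rewrite /= muE.
have mcons (A : set 'rV[R]_n.+1) : measurable A ->
    measurable (@rV_cons R n @^-1` A).
  by move=> mA; have := @measurable_rV_cons _ R n measurableT _ mA; rewrite setTI.
have l0 : lebesgue_rV n.+1 (set0 : set 'rV[R]_n.+1) = 0%E.
  by rewrite leE /pushforward preimage_set0 measure0.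
have lge0 (A : set 'rV[R]_n.+1) : (0 <= lebesgue_rV n.+1 A)%E.
  by rewrite leE /pushforward; exact: measure_ge0.
have lsa : semi_sigma_additive (@lebesgue_rV R n.+1).
  rewrite leE => F mF tF mUF; rewrite /pushforward preimage_bigcup.
  apply: measure_semi_sigma_additive.
  - by move=> k; exact: mcons.
  - apply/trivIsetP => /= i j _ _ ij; rewrite -preimage_setI.
    by move/trivIsetP : tF => /(_ _ _ _ _ ij) ->//; rewrite preimage_set0.
  - by rewrite -preimage_bigcup; exact: mcons.
have lsf : sigma_finite [set: 'rV[R]_n.+1] (lebesgue_rV n.+1).
  have /sigma_finiteP[F [TF ndF Foo]] := sigma_finiteT (@lebesgue_measure R).
  have /sigma_finiteP[G [TG ndG Goo]] := sigma_finiteT mu.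
  pose s (v : 'rV[R]_n.+1) : measurableTypeR R * 'rV[R]_n :=
    (v ord0 ord0, \row_i v ord0 (lift ord0 i)).
  have ms : measurable_fun [set: 'rV[R]_n.+1] s.
    apply/measurable_fun_pairP; split; first exact: measurable_coord.
    apply/measurable_fun_coordP => i.
    under eq_fun do rewrite mxE.
    exact: measurable_coord.
  have consK : cancel (@rV_cons R n) s.
    move=> [x v]; rewrite /s rV_cons0; congr pair.
    by apply/rowP => i; rewrite mxE rV_consS.
  have sFG k : @rV_cons R n @^-1` (s @^-1` (F k `*` G k)) = F k `*` G k.
    by rewrite -comp_preimage (_ : s \o _ = id)//; apply/funext => p;
      exact: consK.
  exists (fun k => s @^-1` (F k `*` G k)).
    apply/seteqP; split => // v _.
    have [i _ Fi] : (\bigcup_i F i) (s v).1 by rewrite -TF.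
    have [j _ Gj] : (\bigcup_i G i) (s v).2 by rewrite -TG.
    exists (maxn i j) => //; split => /=.
      by move: Fi; exact/subsetPset/ndF/leq_maxl.
    by move: Gj; exact/subsetPset/ndG/leq_maxr.
  move=> k; have [mF Fk] := Foo k; have [mG Gk] := Goo k.
  have mFG : measurable (F k `*` G k) by exact: measurableX.
  split; first by rewrite -[X in measurable X]setTI; exact: ms.
  rewrite leE /pushforward sFG /nu/= product_measure1E//.
  by rewrite lte_mul_pinfty// ge0_fin_numE.
pose mix := isMeasure.Build _ _ _ (@lebesgue_rV R n.+1) l0 lge0 lsa.
pose m : {measure set 'rV[R]_n.+1 -> \bar R} :=
  HB.pack (@lebesgue_rV R n.+1) mix.
pose mixs := Measure_isSigmaFinite.Build _ _ _ m lsf.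
pose m' : {sigma_finite_measure set 'rV[R]_n.+1 -> \bar R} :=
  HB.pack (@lebesgue_rV R n.+1) m mixs.
by exists m'.
Qed.

Section lebesgue_rV_measure.
Context {R : realType} {n : nat}.

Let l0 : lebesgue_rV n (set0 : set 'rV[R]_n) = 0%E.
Proof. by have [mu ->] := lebesgue_rV_sigma_finite_measure R n. Qed.

Let lge0 (A : set 'rV[R]_n) : (0 <= lebesgue_rV n A)%E.
Proof. by have [mu ->] := lebesgue_rV_sigma_finite_measure R n. Qed.

Let lsa : semi_sigma_additive (@lebesgue_rV R n).
Proof.
have [mu ->] := lebesgue_rV_sigma_finite_measure R n.
exact: measure_semi_sigma_additive.
Qed.

HB.instance Definition _ := isMeasure.Build _ _ _ (@lebesgue_rV R n) l0 lge0 lsa.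

Let lsf : sigma_finite [set: 'rV[R]_n] (lebesgue_rV n).
Proof.
have [mu ->] := lebesgue_rV_sigma_finite_measure R n.
exact: sigma_finiteT.
Qed.

HB.instance Definition _ :=
  Measure_isSigmaFinite.Build _ _ _ (@lebesgue_rV R n) lsf.

End lebesgue_rV_measure.

Lemma lebesgue_rV_box (R : realType) n (A : 'I_n -> set R) :
  (forall i, measurable (A i)) ->
  lebesgue_rV n [set v : 'rV[R]_n | forall i, A i (v ord0 i)] =
    (\prod_(i < n) lebesgue_measure (A i))%E.
Proof.
elim: n A => [|n IHn] A mA.
  by rewrite big_ord0 /= diracE mem_set// => -[].
rewrite big_ord_recl /= /pushforward rV_cons_box product_measure1E//.
  by congr (_ * _)%E; exact: (IHn (fun i => A (lift ord0 i))).
  exact: mA.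
exact: (@measurable_box R n (fun i => A (lift ord0 i))).
Qed.

Lemma open_measurable_rV (R : realType) n (A : set 'rV[R]_n) :
  open A -> measurable A.
Proof.
move=> oA.
pose box (q : 'rV[rat]_n * rat) :=
  [set v : 'rV[R]_n | forall i,
     ball (ratr (q.1 ord0 i) : R) (ratr q.2 : R) (v ord0 i)].
have -> : A = \bigcup_(q in [set q | box q `<=` A]) box q.
  apply/seteqP; split => [v Av|v [q qA] /qA//].
  have /nbhs_ballP[e /= e0 veA] : nbhs v A by exact: open_nbhs_nbhs.
  have [r] := rat_in_itvoo (divr_gt0 e0 (ltr0Sn R 1)).
  rewrite in_itv/= => /andP[r0 re].
  have /choice[q qP] i : exists q, `|v ord0 i - ratr q| < ratr r.
    have [|q] := @rat_in_itvoo R (v ord0 i - ratr r) (v ord0 i + ratr r).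
      by rewrite ltrBlDr -addrA ltrDl addr_gt0.
    rewrite in_itv/= => /andP[q1 q2]; exists q.
    by rewrite ltr_distlC q1.
  exists (\row_i q i, r) => /=.
    move=> w bw; apply: veA; split=> // i j; rewrite ord1.
    have := bw j; rewrite /= /ball/= mxE => wj.
    rewrite /ball/= (splitr e) (le_lt_trans (ler_distD (ratr (q j)) _ _))//.
    by rewrite ltrD// ?(lt_trans (qP j))// (lt_trans wj).
  by move=> i; rewrite /ball/= mxE distrC.
rewrite bigcup_mkcond; apply: countable_bigcupT_measurable => [|q].
  exact: countableP.
case: ifPn => // _; apply: (@measurable_box _ _
  (fun i => ball (ratr (q.1 ord0 i) : R) (ratr q.2 : R))) => i.
by rewrite ball_itv; exact: measurable_itv.
Qed.

Definition convex_hull (R : realType) d (A : set 'rV[R]_d) : set 'rV[R]_d :=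
  smallest (@convex_set R 'rV[R]_d) A.

Definition convex_body (R : realType) d (K : set 'rV[R]_d) :=
  [/\ compact K, @convex_set R 'rV[R]_d K & K° !=set0].

(* The library's norm on ['rV[R]_d] is the sup norm. *)
Definition euclidean_norm (R : realType) d (x : 'rV[R]_d) : R :=
  Num.sqrt (\sum_(i < d) x ord0 i ^+ 2).

Definition euclidean_unit_ball (R : realType) d : set 'rV[R]_d :=
  [set x | euclidean_norm x <= 1].
Arguments euclidean_unit_ball : clear implicits.

Definition probability_density (R : realType) d (f : 'rV[R]_d -> R) :=
  [/\ measurable_fun [set: 'rV[R]_d] f, forall x, 0 <= f x &
      (\int[lebesgue_rV d]_x (f x)%:E = 1)%E].

Definition has_density d0 (T : measurableType d0) (R : realType)
    (P : probability T R) d (X : {RV P >-> 'rV[R]_d}) (f : 'rV[R]_d -> R) :=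
  forall A, measurable A ->
    distribution P X A = (\int[lebesgue_rV d]_(x in A) (f x)%:E)%E.
Arguments has_density {d0 T R} P {d} X f.

Definition mutually_independent d0 d1 (T : measurableType d0)
    (T' : measurableType d1) (R : realType) (P : probability T R) n
    (X : 'I_n -> {RV P >-> T'}) :=
  forall (J : {set 'I_n}) (A : 'I_n -> set T'),
    (forall i, measurable (A i)) ->
    P (\bigcap_(i in [set` J]) X i @^-1` A i) =
      (\prod_(i in J) P (X i @^-1` A i))%E.
Arguments mutually_independent {d0 d1 T T' R} P {n} X.

Definition missing_volume (R : realType) d (f : 'rV[R]_d -> R)
    (K L : set 'rV[R]_d) : R :=
  \int[lebesgue_rV d]_(x in K `\` L) f x.

(* Main.v *)
Require Import Defs.
From mathcomp Require Import all_boot all_order all_algebra.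
From mathcomp Require Import all_classical all_reals all_analysis.
From mathcomp Require Import measurable_realfun.
From mathcomp Require Import ring lra zify.

Set Implicit Arguments.
Unset Strict Implicit.
Unset Printing Implicit Defensive.

Import Order.TTheory GRing.Theory Num.Theory.
Import numFieldNormedType.Exports.

Local Open Scope classical_set_scope.
Local Open Scope ring_scope.

(** The proof is a union bound over a net of the convex subsets of the unit cube.

Suppose that a family of [N] convex sets is such that every convex subset of
the cube is within distance [r], in the sense of Hausdorff, of one of them.
Let [H] be the hull of the [n] points, and [G] the [r]-neighbourhood of the
member of the family that is close to [H].  Then [H] is contained in [G] and [G]
in the [2 r]-neighbourhood of [H], so that the missing volume is at most the
probability of the complement of [G] plus a multiple of [M * r].  If the missing
volume exceeds this multiple of [M * r] by [eps], all the points have fallen in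
the set [G], whose probability is at most [1 - eps]; for a fixed [G] this happens
with probability at most [expR (- n * eps)], and for some [G] with
probability at most [N * expR (- n * eps)] ([missing_volume_deviation]).  With
[r] of the order of [n ^ (- 2 / d.+1)] the theorem follows provided that [ln N] is
of the order of [n * r], that is, of [r ^ (- (d - 1) / 2)].

A net of this size is Bronshtein's theorem on the entropy of convex sets.  It
is proved here in the following way.  A convex set [L] is described by the
function [potential L], equal to the squared norm minus the squared distance
to [L], and by its gradient, twice the point of [L] that is nearest to the
argument.  The gradient is Lipschitz, so that the potential is a function with
bounded second derivatives.  On the boundary of a cube twice as large as the
unit cube, which has dimension [d - 1], consider a grid of mesh [1 / m]; record the
potential with precision [1 / m ^ 2] and the nearest point with precision
[1 / m] at the points of the grid.  By Taylor expansion, the values recorded at a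
point of the grid leave only boundedly many possibilities for those recorded
at a neighbouring point ([residual_bound]), as in the theorem of Kolmogorov and
Tikhomirov on the entropy of classes of smooth functions, so that at most
[expR (c * m ^ (d - 1))] records are possible ([card_signature_type]).  The record
determines [L] up to a multiple of [1 / m ^ 2] ([nearest_point_net_stability]):
it determines the distance to [L] from the points of the boundary of the
large cube with precision [1 / m ^ 2], and every ray normal to [L] meets this
boundary.

Two other facts are needed.  The volume gained by a convex set when it is
replaced by its [r]-neighbourhood is at most a multiple of [r]
([lebesgue_rV_shell]); one thickens the set in one direction at a time, and the
section of a convex set by a line is an interval, which grows by at most
[2 * r].  The missing volume is a random variable
([measurable_missing_volume]), because a point is outside the hull of finitely
many points exactly if it is separated from them by a hyperplane with
rational normal vector. *)

(** * Euclidean geometry *)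

Definition dotp (R : realType) d (x y : 'rV[R]_d) : R :=
  \sum_i x ord0 i * y ord0 i.

Section dot_product.
Context {R : realType} {d : nat}.
Implicit Types x y z : 'rV[R]_d.

Lemma dotpC x y : dotp x y = dotp y x.
Proof. by apply: eq_bigr => i _; rewrite mulrC. Qed.

Lemma dotpDl x y z : dotp (x + y) z = dotp x z + dotp y z.
Proof. by rewrite -big_split; apply: eq_bigr => i _; rewrite mxE mulrDl. Qed.

Lemma dotpZl a x y : dotp (a *: x) y = a * dotp x y.
Proof. by rewrite /dotp mulr_sumr; apply: eq_bigr => i _; rewrite mxE mulrA. Qed.

Lemma dotpBl x y z : dotp (x - y) z = dotp x z - dotp y z.
Proof. by rewrite dotpDl -scaleN1r dotpZl mulN1r. Qed.

Lemma dotpDr x y z : dotp z (x + y) = dotp z x + dotp z y.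
Proof. by rewrite dotpC dotpDl !(dotpC z). Qed.

Lemma dotpZr a x y : dotp y (a *: x) = a * dotp y x.
Proof. by rewrite dotpC dotpZl dotpC. Qed.

Lemma dotpBr x y z : dotp z (x - y) = dotp z x - dotp z y.
Proof. by rewrite dotpC dotpBl !(dotpC z). Qed.

Definition dotpE := (dotpBl, dotpBr, dotpDl, dotpDr, dotpZl, dotpZr).

Lemma dotp_ge0 x : 0 <= dotp x x.
Proof. by apply: sumr_ge0 => i _; rewrite -expr2 sqr_ge0. Qed.

Lemma dotp_amgm x y : 2 * dotp x y <= dotp x x + dotp y y.
Proof. by have := dotp_ge0 (x - y); rewrite !dotpE (dotpC y x); lra. Qed.

Lemma coord_le_norm x i : `|x ord0 i| <= `|x|.
Proof.
by rewrite [leRHS](_ : _ = mx_norm x)// mx_normrE; apply/bigmax_geP; right; exists (ord0, i).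
Qed.

Lemma norm_le_coord x (r : R) : 0 <= r -> (forall i, `|x ord0 i| <= r) -> `|x| <= r.
Proof.
move=> r0 xr; rewrite [leLHS](_ : _ = mx_norm x)// mx_normrE; apply/bigmax_leP; split => //.
by move=> [i j] _ /=; rewrite ord1.
Qed.

Lemma coord_sqr_le_dotp x i : x ord0 i ^+ 2 <= dotp x x.
Proof.
rewrite /dotp (bigD1 i)//= -expr2 lerDl; apply: sumr_ge0 => j _.
by rewrite -expr2 sqr_ge0.
Qed.

Lemma dotp_le_coord x (r : R) : 0 <= r -> (forall i, `|x ord0 i| <= r) ->
  dotp x x <= d%:R * r ^+ 2.
Proof.
move=> r0 xr; apply: (@le_trans _ _ (\sum_(i < d) r ^+ 2)).
  apply: ler_sum => i _; rewrite -expr2 -real_normK ?num_real//.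
  by rewrite lerXn2r ?nnegrE.
by rewrite sumr_const card_ord mulr_natl.
Qed.

Lemma norm_attained x : x != 0 -> exists i, `|x ord0 i| = `|x|.
Proof.
rewrite -normr_eq0 => /mx_norm_neq0[[i0 i] /=].
by rewrite ord1 => xi; exists i; rewrite -xi.
Qed.

Lemma dotp_eq0 x : dotp x x <= 0 -> x = 0.
Proof.
move=> x0; apply/rowP => i; rewrite [RHS]mxE; apply/eqP; rewrite -sqrf_eq0.
by apply/eqP/le_anti; rewrite sqr_ge0 (le_trans (coord_sqr_le_dotp _ _) x0).
Qed.

Lemma sqr_dist_continuous y : continuous (fun z => dotp (z - y) (z - y)).
Proof.
apply: (@continuous_big R^o) => [|i _ z]; first exact: add_continuous.
have cz : continuous (fun w : 'rV[R]_d => (w - y) ord0 i).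
  under eq_fun do rewrite !mxE.
  move=> w; have cw := @coord_continuous R 1 d ord0 i w.
  exact: (@cvgB R R^o _ _ (nbhs_filter w) _ _ _ _ cw (cvg_cst _)).
exact: (@cvgM R^o _ _ (nbhs_filter z) _ _ _ _ (cz z) (cz z)).
Qed.

End dot_product.

Lemma convexP (R : realType) d (A : set 'rV[R]_d) :
  @convex_set R 'rV[R]_d A <->
  forall x y (t : R), 0 <= t <= 1 -> A x -> A y -> A (t *: x + (1 - t) *: y).
Proof.
split=> [cA x y t /andP[t0 t1] Ax Ay|cA x y t /set_mem Ax /set_mem Ay].
  by have := cA x y (Itv01 t0 t1) (mem_set Ax) (mem_set Ay) => /set_mem.
by apply/mem_set; apply: cA => //; apply/andP; split.
Qed.

(** * Nearest points *)

Section projection.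
Context {R : realType} {d : nat}.
Implicit Types (L : set 'rV[R]_d) (x y z : 'rV[R]_d).

Definition nearest_point L y : 'rV[R]_d :=
  xget 0 [set p | L p /\ forall z, L z -> dotp (z - p) (y - p) <= 0].

(** Existence of a nearest point, characterised by its obtuse angles with the
other points of [L]: moving from a minimiser [p] of the distance by a fraction
[t] of the way to [z] cannot decrease the distance, and the inner product
is the term of first order in [t] of the change. *)
Lemma nearest_pointP L y : compact L -> @convex_set R 'rV[R]_d L -> L !=set0 ->
  L (nearest_point L y) /\
  forall z, L z -> dotp (z - nearest_point L y) (y - nearest_point L y) <= 0.
Proof.
move=> cL /convexP vL L0.
suff [p Pp] : exists p, L p /\ forall z, L z -> dotp (z - p) (y - p) <= 0.
  by rewrite /nearest_point; case: xgetP => [_ -> //|/(_ p)].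
have cf : {within L, continuous (fun z => dotp (z - y) (z - y))}.
  exact/continuous_subspaceT/sqr_dist_continuous.
have [p /set_mem Lp pmin] := EVT_min_rV L0 cL cf.
exists p; split => // z Lz.
set a := dotp (z - p) (y - p).
have b0 := dotp_ge0 (z - p); set b := dotp (z - p) (z - p) in b0.
have key t : 0 <= t <= 1 -> 2 * t * a <= t ^+ 2 * b.
  move=> t01; have := pmin _ (mem_set (vL _ _ _ t01 Lz Lp)).
  rewrite /a /b !dotpE (dotpC p z) (dotpC y z) (dotpC y p); lra.
rewrite leNgt; apply/negP => a0.
have ab : 0 < a + b by lra.
(* A step at which the linear term still dominates the quadratic one. *)
pose t := a / (a + b).
have t0 : 0 < t by rewrite divr_gt0.
have tab : t * (a + b) = a by rewrite divfK ?gt_eqF.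
have t1 : 0 <= t <= 1 by rewrite (ltW t0) /= ler_pdivrMr// mul1r lerDl.
have := key t t1; rewrite (_ : t ^+ 2 * b = t * (a - t * a)).
  have ta : 0 < t * a by rewrite mulr_gt0.
  have tta : 0 < t * (t * a) by rewrite mulr_gt0.
  lra.
by rewrite -{1}tab; ring.
Qed.

(** The squared distance from [y] to [L] is [dotp y y - potential L y]; the
potential is the more convenient function because it is convex with gradient
[2 *: nearest_point L y]. *)
Definition potential L y : R :=
  2 * dotp (nearest_point L y) y - dotp (nearest_point L y) (nearest_point L y).

Section facts.
Context {L : set 'rV[R]_d}.
Hypotheses (cL : compact L) (vL : @convex_set R 'rV[R]_d L) (L0 : L !=set0).
Local Notation p := (nearest_point L).

Lemma nearest_point_in y : L (p y).
Proof. by have [] := nearest_pointP y cL vL L0. Qed.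

Lemma nearest_point_angle y z : L z -> dotp (z - p y) (y - p y) <= 0.
Proof. by have [_] := nearest_pointP y cL vL L0; exact. Qed.

Lemma nearest_point_nonexpansive x y :
  dotp (p x - p y) (p x - p y) <= dotp (x - y) (x - y).
Proof.
have := nearest_point_angle x (nearest_point_in y).
have := nearest_point_angle y (nearest_point_in x).
have := dotp_amgm (p x - p y) (x - y).
rewrite !dotpE (dotpC (p y) (p x)) (dotpC y x) (dotpC (p x)) (dotpC (p y) y).
rewrite (dotpC (p y) x) (dotpC (p x) y).
lra.
Qed.

Lemma nearest_pointE q y : L q -> (forall z, L z -> dotp (z - q) (y - q) <= 0) ->
  p y = q.
Proof.
move=> Lq qP; have := qP _ (nearest_point_in y); have := nearest_point_angle y Lq.
move=> h1 h2; apply/eqP; rewrite -subr_eq0; apply/eqP.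
apply: dotp_eq0; move: h1 h2; rewrite !dotpE (dotpC q (p y)); lra.
Qed.

(** The lower bound says that the potential is the supremum over [z] in [L] of the
affine functions [2 * dotp z y - dotp z z]; the upper bound is the lower bound
with [y] and [y'] exchanged, combined with the Lipschitz property of the
gradient. *)
Lemma nearest_point_potentialD y y' :
  potential L y + 2 * dotp (p y) (y' - y) <= potential L y' <=
  potential L y + 2 * dotp (p y) (y' - y) + 2 * dotp (y' - y) (y' - y).
Proof.
have low z z' : potential L z + 2 * dotp (p z) (z' - z) <= potential L z'.
  have := nearest_point_angle z' (nearest_point_in z).
  have := dotp_ge0 (p z - p z').
  rewrite /potential !dotpE (dotpC (p z') (p z)) -?(dotpC (p z') z').
  lra.
rewrite low /=; have := low y' y.
have := nearest_point_nonexpansive y' y.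
have := dotp_amgm (p y' - p y) (y' - y).
rewrite !dotpE; lra.
Qed.

End facts.
End projection.

(** * Stability of convex sets under perturbation of the nearest points *)

(** A ray leaving the unit cube has to cross the boundary of the cube twice as
large; the crossing point is found by the intermediate value theorem. *)
Lemma ray_hits_cube (R : realType) d (q x : 'rV[R]_d) : `|q| <= 1 -> x != q ->
  exists2 l : R, 0 < l & `|q + l *: (x - q)| = 2.
Proof.
move=> q1 xq.
have z0 : 0 < `|x - q| by rewrite normr_gt0 subr_eq0.
have cf : {within `[0, 3 / `|x - q|], continuous (fun l => `|q + l *: (x - q)|)}.
  apply: continuous_subspaceT => l.
  apply: (@cvg_norm _ 'rV[R]_d _ _ (nbhs_filter l)).
  apply: (@cvgD _ 'rV[R]_d _ _ (nbhs_filter l)).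
    exact: (@cvg_cst _ _ _ _ (nbhs_filter l)).
  by apply: (@cvgZl _ 'rV[R]_d _ _ (nbhs_filter l)).
have [||l] := @IVT R (fun l => `|q + l *: (x - q)|) 0 (3 / `|x - q|) 2 _ cf.
- by rewrite divr_ge0.
- rewrite scale0r addr0 ge_min (le_trans q1) ?ler1n//= le_max; apply/orP; right.
  have := lerB_normD ((3 / `|x - q|) *: (x - q)) q.
  rewrite normrZ ger0_norm ?divr_ge0// divfK ?gt_eqF// [_ + q]addrC.
  by move=> h; apply: le_trans h; lra.
rewrite in_itv /= => /andP[l0 _] lE; exists l => //.
rewrite lt_neqAle l0 andbT; apply/eqP => l0'.
by move: lE; rewrite -l0' scale0r addr0 => q2; move: q1; rewrite q2; lra.
Qed.

(** For [x] in [L'] with nearest point [q] in [L], let [z] be the point at which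
the ray from [q] through [x] hits the boundary of the cube; [q] is also the
point of [L] that is nearest to [z].  A first-order expansion from a point of
the net [Y] shows that [L] and [L'] have almost equal distances to [z], and
that the point of [L'] nearest to [z] is [q + w] with [w] small.  The angle at
[q + w] between [x] and [z] is obtuse, which prevents [x] from being far beyond
[q] on the ray.

The nearest points are only compared with the precision [eta] of the net,
because they enter the expansion multiplied by a displacement of length
[eta]; the potentials, and the conclusion, have the precision [eta ^+ 2] of a
Taylor expansion of order one. *)
Lemma nearest_point_net_stability (R : realType) d (L L' Y : set 'rV[R]_d) (eta : R) :
  compact L -> @convex_set R 'rV[R]_d L -> L !=set0 ->
  compact L' -> @convex_set R 'rV[R]_d L' -> L' !=set0 ->
  (forall x, L x -> `|x| <= 1) -> (forall x, L' x -> `|x| <= 1) -> 0 <= eta ->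
  (forall z, `|z| = 2 -> exists2 y, Y y & forall i, `|(z - y) ord0 i| <= eta) ->
  (forall y, Y y -> forall i,
    `|(nearest_point L' y - nearest_point L y) ord0 i| <= eta) ->
  (forall y, Y y -> `|potential L' y - potential L y| <= eta ^+ 2) ->
  forall x, L' x -> exists2 q, L q & `|x - q| <= 42 * d%:R * eta ^+ 2.
Proof.
move=> cL vL L0 cL' vL' L'0 L1 L'1 eta0 netY pY potY x L'x.
set q := nearest_point L x.
have Lq : L q by exact: nearest_point_in.
exists q => //; have [->|xq] := eqVneq x q.
  by rewrite subrr normr0 !mulr_ge0// sqr_ge0.
have [l l0 zE] := ray_hits_cube (L1 _ Lq) xq; set z := q + _ in zE.
have vE : z - q = l *: (x - q) by rewrite /z addrC addKr.
clearbody z.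
have pz : nearest_point L z = q.
  apply: nearest_pointE => // t Lt; rewrite vE dotpZr pmulr_rle0//.
  exact: nearest_point_angle.
have [|i] := @norm_attained _ _ z; first by rewrite -normr_gt0 zE.
rewrite zE => zi.
have d1 : 1 <= d%:R :> R by rewrite ler1n (leq_trans _ (ltn_ord i)).
have [y Yy yz] := netY _ zE.
set delta := d%:R * eta ^+ 2.
have eta_delta : eta ^+ 2 <= delta by rewrite ler_peMl// sqr_ge0.
have zy_delta : dotp (z - y) (z - y) <= delta by exact: dotp_le_coord.
have b_delta := dotp_le_coord eta0 (pY _ Yy); rewrite -/delta in b_delta.
have a_delta := nearest_point_nonexpansive cL' vL' L'0 z y.
have c_delta := nearest_point_nonexpansive cL vL L0 y z.
have potL := nearest_point_potentialD cL vL L0 y z.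
have potL' := nearest_point_potentialD cL' vL' L'0 y z.
have := nearest_point_angle cL' vL' L'0 z L'x.
rewrite pz in c_delta; move/andP: potL => [potL _].
move/andP: potL' => [_ potL'].
have potLL' : potential L' y - potential L y <= eta ^+ 2.
  exact: le_trans (ler_norm _) (potY _ Yy).
have potz : potential L z = 2 * dotp q z - dotp q q by rewrite /potential pz.
have potz' : potential L' z = 2 * dotp (nearest_point L' z) z -
  dotp (nearest_point L' z) (nearest_point L' z) by [].
move: a_delta b_delta c_delta potL potL' potz potz' potLL'.
set p'z := nearest_point L' z; set p' := nearest_point L' y.
set p := nearest_point L y => a_delta b_delta c_delta potL potL' potz potz' potLL' angle.
have bzy := dotp_amgm (p' - p) (z - y).
set v := z - q; pose w := p'z - q; pose s := l^-1.
(* From [z] to the net, across from [L] to [L'], and back to [z]: three steps of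
squared length [delta]. *)
have w_delta : dotp w w <= 9 * delta.
  rewrite /w (_ : p'z - q = (p'z - p') + (p' - p) + (p - q)); last first.
    by rewrite !subrKA.
  have ab := dotp_amgm (p'z - p') (p' - p).
  have ac := dotp_amgm (p'z - p') (p - q).
  have bc := dotp_amgm (p' - p) (p - q).
  have yz_delta : dotp (y - z) (y - z) <= delta.
    by move: zy_delta; rewrite !dotpE; lra.
  move: ab ac bc (le_trans a_delta zy_delta) b_delta (le_trans c_delta yz_delta).
  move: (p'z - p') (p' - p) (p - q) => a b c.
  rewrite !dotpDl !dotpDr (dotpC b a) (dotpC c a) (dotpC c b).
  lra.
(* This is the comparison of the squared distances [dotp v v] from [z] to [L]
and [dotp (v - w) (v - w)] from [z] to [L']: their difference is at most
[5 * delta], and [dotp w w] at most [9 * delta]. *)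
have vw_delta : 2 * dotp v w <= 14 * delta.
  have -> : 2 * dotp v w = dotp w w + potential L' z - potential L z.
    rewrite potz potz' /v /w !dotpE (dotpC z p'z) (dotpC z q) (dotpC q p'z).
    by ring.
  move: potL potL' bzy; rewrite (dotpBl p' p (z - y)); lra.
have xqE : x - q = s *: v by rewrite /v vE scalerA mulVf ?gt_eqF// scale1r.
have s0 : 0 < s by rewrite invr_gt0.
have v1 : 1 <= dotp v v.
  apply: le_trans (coord_sqr_le_dotp _ i); rewrite -real_normK ?num_real//.
  rewrite exprn_ege1// !mxE.
  have := le_trans (coord_le_norm q i) (L1 _ Lq).
  by have := lerB_dist (z ord0 i) (q ord0 i); rewrite zi; lra.
have v3 : `|v| <= 3.
  by apply: le_trans (ler_normB _ _) _; have := L1 _ Lq; rewrite zE; lra.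
have {angle} : s * (dotp v v - dotp v w) <= dotp v w - dotp w w.
  have xp'z : x - p'z = s *: v - w by rewrite -xqE /w opprB addrA subrK.
  have zp'z : z - p'z = v - w by rewrite /w /v opprB addrA subrK.
  move: angle; rewrite xp'z zp'z; clearbody v w.
  rewrite !dotpE (dotpC w v); lra.
rewrite -mulrA -/delta.
have := dotp_ge0 w => w0 sle.
(* If [dotp v w] is not small, neither is [delta], and the conclusion only says
that points of the unit cube are at distance at most 2. *)
have [vw|vw] := leP (dotp v w) (1 / 2); last first.
  apply: le_trans (ler_normB _ _) _.
  by have := L1 _ Lq; have := L'1 _ L'x; lra.
have sv : 0 <= s * (dotp v v - dotp v w - 1 / 2) by apply: mulr_ge0; [exact: ltW|lra].
have s_delta : s <= 14 * delta by lra.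
rewrite xqE normrZ gtr0_norm//.
by apply: le_trans (ler_pM (ltW s0) (normr_ge0 _) s_delta v3) _; lra.
Qed.

(** * Encoding convex sets *)

Lemma inord_absz_inj (W : nat) (a b : int) :
  0 <= a <= W%:Z -> 0 <= b <= W%:Z ->
  inord (absz a) = inord (absz b) :> 'I_W.+1 -> a = b.
Proof.
move=> /andP[a0 aW] /andP[b0 bW] /(congr1 (@nat_of_ord _)).
by rewrite !inordK; lia.
Qed.

Lemma eq_floor_dist (R : realType) (a b : R) :
  Num.floor a = Num.floor b -> `|a - b| <= 1.
Proof.
move=> ab; have := floor_itv a; have := floor_itv b; rewrite ab intrD.
by rewrite ler_distl => /andP[b1 b2] /andP[a1 a2]; apply/andP; split; lra.
Qed.

Section code.
Context {R : realType} {e : nat} (m : nat).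
Local Notation d := e.+1.
Implicit Types (L : set 'rV[R]_d) (y : 'rV[R]_d) (i : 'I_d) (s : bool).
Implicit Types (k : 'I_e -> nat) (j : 'I_e) (o : option 'I_d).

(** The nearest point, as a gradient, is recorded with precision [1 / m], but the
potential with precision [1 / m ^ 2]: these are the precisions preserved by a
Taylor expansion of order one on a grid of mesh [1 / m]. *)
Definition code L y o : int :=
  if o is Some i then Num.floor (m%:R * nearest_point L y ord0 i)
  else Num.floor (m%:R ^+ 2 * potential L y).

(** The grid of mesh [1 / m] on the face of the cube of side 4 centred at the
origin where coordinate [i] is [2] or [-2], according to the sign [s]. *)
Definition face_point i s k : 'rV[R]_d :=
  \row_l (if unlift i l is Some j then (k j)%:R / m%:R - 2 else (-1) ^+ s * 2).

Definition next k j : 'I_e -> nat := fun l => (k l + (l == j))%N.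

(** The variation of the code along an edge of the grid, corrected for the
potential by its first-order expansion. *)
Definition residual L i s k j o : int :=
  code L (face_point i s (next k j)) o - code L (face_point i s k) o -
  (if o is None then 2 * code L (face_point i s k) (Some (lift i j)) else 0).

Lemma face_point_next i s k j :
  face_point i s (next k j) - face_point i s k = m%:R^-1 *: delta_mx ord0 (lift i j).
Proof.
apply/rowP => l; rewrite !mxE eqxx/=.
have [l' ->|->] := unliftP i l; last first.
  by rewrite (negbTE (neq_lift _ _)) mulr0 subrr.
rewrite (inj_eq (@lift_inj _ i)) /next.
by rewrite natrD; case: eqP => _ /=; ring.
Qed.

Hypothesis m0 : (0 < m)%N.

(** Along an edge of length [1 / m] the nearest point moves by at most [1 / m],
which is one unit of its code, and the potential deviates from its
first-order expansion by at most [2 / m ^ 2], which is two units of its code;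
taking integer parts contributes the rest. *)
Lemma residual_bound L i s k j o :
  compact L -> @convex_set R 'rV[R]_d L -> L !=set0 ->
  -1 <= residual L i s k j o <= 4.
Proof.
move=> cL vL L0; rewrite /residual.
have := nearest_point_potentialD cL vL L0 (face_point i s k) (face_point i s (next k j)).
have := nearest_point_nonexpansive cL vL L0 (face_point i s (next k j)) (face_point i s k).
rewrite face_point_next.
set y := face_point i s k; set y' := face_point i s (next k j).
set D := m%:R^-1 *: _.
have mR : 0 < m%:R :> R by rewrite ltr0n.
have DE (x : 'rV[R]_d) : dotp x D = x ord0 (lift i j) / m%:R.
  rewrite dotpZr mulrC; congr (_ * _); rewrite /dotp (bigD1 (lift i j))//= big1.
    by rewrite mxE !eqxx mulr1 addr0.
  by move=> l /negbTE lj; rewrite mxE lj andbF mulr0.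
rewrite !DE mxE mxE !eqxx mulr1.
case: o => [l|] /=; last first.
  move=> _ /andP[h1 h2].
  have := floor_itv (m%:R ^+ 2 * potential L y).
  have := floor_itv (m%:R ^+ 2 * potential L y').
  have := floor_itv (m%:R * nearest_point L y ord0 (lift i j)).
  set a := Num.floor _; set b := Num.floor _; set c := Num.floor _.
  rewrite !intrD => /andP[a1 a2] /andP[b1 b2] /andP[c1 c2].
  have {}h1 : m%:R ^+ 2 * potential L y + 2 * (m%:R * nearest_point L y ord0 (lift i j))
      <= m%:R ^+ 2 * potential L y'.
    rewrite -(ler_pM2l (_ : 0 < m%:R ^+ 2)) ?exprn_gt0// in h1.
    apply: le_trans h1; rewrite le_eqVlt; apply/orP; left; apply/eqP; field.
    by rewrite gt_eqF.
  have {}h2 : m%:R ^+ 2 * potential L y' <=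
     m%:R ^+ 2 * potential L y + 2 * (m%:R * nearest_point L y ord0 (lift i j)) + 2.
    rewrite -(ler_pM2l (_ : 0 < m%:R ^+ 2)) ?exprn_gt0// in h2.
    apply: (le_trans h2); rewrite le_eqVlt; apply/orP; left; apply/eqP; field.
    by rewrite gt_eqF.
  have : (b - c - 2 * a)%:~R < 5%:~R :> R by rewrite !intrD !rmorphN/= rmorphM/=; lra.
  have : (-2)%:~R < (b - c - 2 * a)%:~R :> R by rewrite !intrD !rmorphN/= rmorphM/=; lra.
  by rewrite !ltr_int; lia.
move=> /(le_trans (coord_sqr_le_dotp _ l)) h _.
have {}h : `|m%:R * nearest_point L y' ord0 l - m%:R * nearest_point L y ord0 l| <= 1.
  rewrite -mulrBr normrM gtr0_norm// -ler_pdivlMl// mulr1.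
  rewrite -(@ler_pXn2r _ 2)// ?nnegrE ?invr_ge0 ?ler0n//.
  by rewrite real_normK ?num_real//; move: h; rewrite !mxE !expr2.
move: h; have := floor_itv (m%:R * nearest_point L y ord0 l).
have := floor_itv (m%:R * nearest_point L y' ord0 l).
set a := Num.floor _; set b := Num.floor _.
rewrite ler_norml !intrD => /andP[a1 a2] /andP[b1 b2] /andP[c1 c2].
have : (a - b - 0)%:~R < 2%:~R :> R by rewrite !intrD !rmorphN/=; lra.
have : (-2)%:~R < (a - b - 0)%:~R :> R by rewrite !intrD !rmorphN/=; lra.
by rewrite !ltr_int; lia.
Qed.

Lemma code_bound L y o :
  compact L -> @convex_set R 'rV[R]_d L -> L !=set0 ->
  (forall x, L x -> `|x| <= 1) -> (forall i, `|y ord0 i| <= 2) ->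
  0 <= code L y o + (6 * d * m ^ 2)%N%:Z <= (12 * d * m ^ 2)%N%:Z.
Proof.
move=> cL vL L0 L1 y2.
have mR : 1 <= m%:R :> R by rewrite ler1n.
have p1 i : `|nearest_point L y ord0 i| <= 1.
  exact: le_trans (coord_le_norm _ _) (L1 _ (nearest_point_in cL vL L0 y)).
suff [x /andP[x1 x2] ->] : exists2 x : R,
    - (6 * d * m ^ 2)%:R <= x <= (6 * d * m ^ 2)%:R & code L y o = Num.floor x.
  have := floor_itv x; set a := Num.floor x; rewrite intrD => /andP[a1 a2].
  have : (- (6 * d * m ^ 2)%N%:Z - 1)%:~R < a%:~R :> R.
    by rewrite intrD !rmorphN/= -[(_ %:Z)%:~R]/((6 * d * m ^ 2)%:R : R); lra.
  have : a%:~R <= ((6 * d * m ^ 2)%N%:Z)%:~R :> R by exact: le_trans x2.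
  by rewrite ltr_int ler_int; lia.
rewrite natrM natrX.
have d1 : 1 <= d%:R :> R by rewrite ler1n.
have m2 : m%:R <= m%:R ^+ 2 :> R by rewrite expr2 ler_peMl// (le_trans _ mR).
have m20 : 0 <= m%:R ^+ 2 :> R by exact: sqr_ge0.
case: o => [i|] /=; last first.
  exists (m%:R ^+ 2 * potential L y) => //.
  have p2 := dotp_le_coord ler01 p1; rewrite expr1n mulr1 in p2.
  have ypos := dotp_le_coord (ler0n R 2) y2.
  have := dotp_ge0 (nearest_point L y).
  have pyP := dotp_amgm (nearest_point L y) y.
  have pyN := dotp_amgm (nearest_point L y) (- y).
  have yN : dotp (- y) (- y) = dotp y y by rewrite -scaleN1r dotpZl dotpZr; ring.
  rewrite yN -scaleN1r dotpZr in pyN.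
  move=> p0.
  rewrite -ler_norml normrM ger0_norm// mulrC ler_wpM2r// natrM.
  by rewrite ler_norml /potential; apply/andP; split; lra.
exists (m%:R * nearest_point L y ord0 i) => //.
rewrite -ler_norml normrM ger0_norm ?(le_trans _ mR)//.
apply: (@le_trans _ _ m%:R); first by rewrite ler_piMr ?(le_trans _ mR).
by rewrite (le_trans m2)// ler_peMl// natrM; lra.
Qed.

End code.

(** * A net of convex sets *)

Definition unit_convex (R : realType) d (L : set 'rV[R]_d) :=
  [/\ compact L, @convex_set R 'rV[R]_d L, L !=set0 & forall x, L x -> `|x| <= 1].

Section net.
Context {R : realType} {e : nat} (m : nat).
Local Notation d := e.+1.
Implicit Types (L : set 'rV[R]_d) (i : 'I_d) (s : bool) (k : 'I_e -> nat).
Hypothesis m0 : (0 < m)%N.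

Lemma face_point_dense (z : 'rV[R]_d) : `|z| = 2 ->
  exists i s k, (forall j, k j <= 4 * m)%N /\
    forall l, `|(z - face_point m i s k) ord0 l| <= m%:R^-1.
Proof.
move=> z2; have mR : 0 < m%:R :> R by rewrite ltr0n.
have [|i] := @norm_attained _ _ z; first by rewrite -normr_gt0 z2.
rewrite z2 => zi.
have zl l : -2 <= z ord0 l <= 2 by rewrite -ler_norml -z2 coord_le_norm.
exists i, (z ord0 i < 0), (fun j => Num.truncn (m%:R * (z ord0 (lift i j) + 2))).
have ge0 j : 0 <= m%:R * (z ord0 (lift i j) + 2).
  by rewrite (mulr_ge0 (ltW mR))//; have /andP[] := zl (lift i j); lra.
split=> [j|l].
  rewrite -(ler_nat R); apply: (@le_trans _ _ (m%:R * (z ord0 (lift i j) + 2))).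
    by rewrite truncn_le.
  by rewrite natrM mulrC (ler_wpM2r (ltW mR))//; have /andP[] := zl (lift i j); lra.
rewrite !mxE; have [j ->|->] := unliftP i l; last first.
  move: zi; have [zi0|zi0] := ltP (z ord0 i) 0.
    by rewrite ltr0_norm// => zi; rewrite expr1 mulN1r opprK -zi subrr normr0 invr_ge0 ltW.
  by rewrite ger0_norm// => zi; rewrite expr0 mul1r -zi subrr normr0 invr_ge0 ltW.
have := truncn_itv (ge0 j); set t := Num.truncn _ => /andP[t1 t2].
have -> : z ord0 (lift i j) - (t%:R / m%:R - 2) =
    m%:R^-1 * (m%:R * (z ord0 (lift i j) + 2) - t%:R).
  by field; rewrite gt_eqF.
rewrite normrM gtr0_norm ?invr_gt0// ger_pMr ?invr_gt0// ler_norml.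
by rewrite -natr1 in t2; apply/andP; split; lra.
Qed.

Let W := (12 * d * m ^ 2)%N.

Definition signature_type : finType :=
  ({ffun 'I_d * bool * option 'I_d -> 'I_W.+1} *
   {ffun 'I_d * bool * {ffun 'I_e -> 'I_(4 * m).+1} * 'I_e * option 'I_d -> 'I_6})%type.

(** The code at one corner of every face, and all the residuals.  The shifts make
these integers nonnegative, so that no information is lost when they are
truncated to an ordinal. *)
Definition signature L : signature_type :=
  ([ffun a => inord (absz (code m L (face_point m a.1.1 a.1.2 (fun=> 0%N)) a.2
       + (6 * d * m ^ 2)%N%:Z))],
   [ffun b : 'I_d * bool * {ffun 'I_e -> 'I_(4 * m).+1} * 'I_e * option 'I_d =>
     inord (absz (residual m L b.1.1.1.1 b.1.1.1.2
       (fun j => nat_of_ord (b.1.1.2 j)) b.1.2 b.2 + 1))]).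

(** Every point of the grid is reached from the corner along edges, and the
residuals determine the variation of the code along them. *)
Lemma signature_code L L' i s k : unit_convex L -> unit_convex L' ->
  signature L = signature L' -> (forall j, k j <= 4 * m)%N ->
  forall o, code m L (face_point m i s k) o = code m L' (face_point m i s k) o.
Proof.
move=> [cL vL L0 L1] [cL' vL' L'0 L'1] sigE.
move En : (\sum_j k j)%N => n; elim: n k En => [|n IHn] k En km o.
  have -> : k = fun=> 0%N.
    apply/funext => j; apply/eqP; have := leqnn (\sum_j k j)%N.
    by rewrite {2}En leqn0 sum_nat_eq0 => /forallP/(_ j).
  have /(congr1 (fun t : signature_type => t.1 (i, s, o))) := sigE.
  have y2 l : `|@face_point R e m i s (fun=> 0%N) ord0 l| <= 2.
    rewrite mxE; case: unlift => [j|]; first by rewrite mul0r sub0r normrN ger0_norm.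
    by rewrite normrM normrX normrN1 expr1n mul1r ger0_norm.
  rewrite /= !ffunE /= => /inord_absz_inj.
  rewrite !code_bound// => /(_ isT isT)/eqP.
  by rewrite (inj_eq (addIr _)) => /eqP.
have [j kj] : exists j, (0 < k j)%N.
  apply/existsP; rewrite -[X in is_true X]negbK negb_exists; apply/negP => /forallP k0.
  by move: En; rewrite big1// => j _; apply/eqP; rewrite -leqn0 leqNgt; exact: k0.
pose k' l := (k l - (l == j))%N.
have kE : k = next k' j.
  by apply/funext => l; rewrite /next /k'; case: eqP => [->|_]; rewrite ?subnK// subn0 addn0.
have k'm l : (k' l <= 4 * m)%N by rewrite (leq_trans _ (km l))// leq_subr.
have k'n : (\sum_j k' j)%N = n.
  apply/eqP; rewrite -(eqn_add2r 1%N) [X in _ == X]addn1 -En kE /next big_split/= eqn_add2l.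
  by rewrite (bigD1 j)//= eqxx big1// => l /negbTE ->.
have /(congr1 (fun t : signature_type => t.2 (i, s, [ffun l => inord (k' l)], j, o))) := sigE.
rewrite /= !ffunE /=.
have -> : (fun l => nat_of_ord ([ffun l => inord (k' l) : 'I_(4 * m).+1] l)) = k'.
  by apply/funext => l; rewrite ffunE inordK ?ltnS ?k'm.
move=> /inord_absz_inj.
have r5 L2 : compact L2 -> @convex_set R 'rV[R]_d L2 -> L2 !=set0 ->
    0 <= residual m L2 i s k' j o + 1 <= 5%:Z.
  by move=> c2 v2 n2; have := residual_bound m0 i s k' j o c2 v2 n2; lia.
rewrite !r5// => /(_ isT isT).
rewrite /residual kE !(IHn k' k'n k'm).
by clear r5; case: o => [l|]; lia.
Qed.

Lemma signature_close L L' : unit_convex L -> unit_convex L' ->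
  signature L = signature L' ->
  forall x, L' x -> exists2 q, L q & `|x - q| <= 42 * d%:R / m%:R ^+ 2.
Proof.
move=> cL cL' sigE; have [cL1 vL L0 L1] := cL; have [cL'1 vL' L'0 L'1] := cL'.
have mR : 0 < m%:R :> R by rewrite ltr0n.
rewrite -exprVn.
pose Y : set 'rV[R]_d := [set y | exists i s k, (forall j, k j <= 4 * m)%N /\
   y = face_point m i s k].
apply: (@nearest_point_net_stability R d L L' Y) => //.
- move=> z /face_point_dense[i [s [k [km zk]]]].
  by exists (face_point m i s k) => //; exists i, s, k.
- move=> y [i [s [k [km ->]]]] l.
  have /eq_floor_dist := signature_code i s cL cL' sigE km (Some l).
  rewrite -mulrBr normrM gtr0_norm// distrC -ler_pdivlMl// mulr1.
  by rewrite !mxE.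
- move=> y [i [s [k [km ->]]]].
  have /eq_floor_dist := signature_code i s cL cL' sigE km None.
  have m2 : 0 < m%:R ^+ 2 :> R by rewrite exprn_gt0.
  by rewrite -mulrBr normrM (gtr0_norm m2) distrC -ler_pdivlMl// mulr1 exprVn.
Qed.

(** A default value is needed for the signatures that no convex set has. *)
Definition representative (t : signature_type) : set 'rV[R]_d :=
  xget [set 0] [set L | unit_convex L /\ signature L = t].

Lemma representativeP (t : signature_type) : unit_convex (representative t).
Proof.
rewrite /representative; case: xgetP => [L _ []//|_].
split; [exact: compact_set1| |by exists 0|by move=> x ->; rewrite normr0 ler01].
by apply/convexP => x y l _ -> ->; rewrite !scaler0 addr0.
Qed.

Lemma signature_representative L : unit_convex L ->
  signature (representative (signature L)) = signature L.
Proof.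
move=> cL; rewrite {1}/representative.
by case: xgetP => [L' _ []//|/(_ L)[]].
Qed.

End net.

(** The logarithm of the number of signatures is dominated by the number of
edges, of the order of [m ^ e].  The codes at the corners of the faces, vectors
of [e.+2] integers of the order of [m ^ 2] at most, only contribute a constant
and a multiple of [ln m], dominated by [m ^ e] because [e] is positive. *)
Lemma card_signature_type (R : realType) (e m : nat) : (0 < e)%N -> (0 < m)%N ->
  #|@signature_type e m|%:R <=
    expR ((((13 * e.+1 + 2) * (e.+1 * 2 * e.+2) +
           6 * (e.+1 * 2 * 5 ^ e * e * e.+2))%N)%:R * m%:R ^+ e) :> R.
Proof.
move=> e0 m0; have mR : 1 <= m%:R :> R by rewrite ler1n.
have nexp (n : nat) : n%:R <= expR n%:R :> R.
  by rewrite (le_trans _ (expR_ge1Dx _))// lerDr.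
rewrite card_prod !card_ffun !card_prod card_ffun !card_option !card_ord card_bool.
rewrite natrM natrD mulrDl expRD ler_pM//.
  rewrite natrX natrM mulrAC -[leRHS]/(expR (_ * _)) mulrC.
  rewrite expRM_natl lerXn2r ?nnegrE ?expR_ge0 ?ler0n//.
  apply: (@le_trans _ _ ((13 * e.+1) * m ^ 2)%N%:R).
    by rewrite ler_nat; nia.
  rewrite natrM natrX.
  apply: (@le_trans _ _ (expR (13 * e.+1)%:R * expR m%:R ^+ 2)).
    by rewrite ler_pM// lerXn2r ?nnegrE ?expR_ge0 ?ler0n.
  rewrite -expRM_natl -expRD ler_expR [(13 * e.+1 + 2)%:R]natrD [leRHS]mulrDl.
  have me : m%:R <= m%:R ^+ e :> R by rewrite -[leLHS]expr1 ler_weXn2l.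
  rewrite lerD//; last by rewrite ler_wpM2l.
  by rewrite ler_peMr// exprn_ege1.
rewrite natrX.
have -> : (6 * (e.+1 * 2 * 5 ^ e * e * e.+2))%N%:R * m%:R ^+ e =
   (e.+1 * 2 * (5 * m) ^ e * e * e.+2)%N%:R * 6 :> R.
  by rewrite -natrX -!natrM; congr (_%:R); rewrite expnMn; lia.
rewrite expRM_natl.
apply: (@le_trans _ _ (6 ^+ (e.+1 * 2 * (5 * m) ^ e * e * e.+2))).
  rewrite ler_weXn2l ?ler1n// !leq_mul// leq_exp2r//; lia.
by rewrite lerXn2r ?nnegrE ?expR_ge0 ?ler0n// nexp.
Qed.

(** * Volume of the neighbourhoods of a convex set *)

Lemma ge0_integral_le_cst d (T : measurableType d) (R : realType)
    (mu : {measure set T -> \bar R}) (f : T -> \bar R) (D : set T) (r : R) :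
  measurable D -> measurable_fun setT f -> 0 <= r ->
  (forall x, (0 <= f x)%E) -> (forall x, D x -> (f x <= r%:E)%E) ->
  (forall x, ~ D x -> f x = 0%E) ->
  (\int[mu]_x f x <= r%:E * mu D)%E.
Proof.
move=> mD mf r0 f0 fr fD.
rewrite (_ : (\int[mu]_x f x = \int[mu]_(x in D) f x)%E).
  rewrite -integral_cst//; apply: ge0_le_integral => //.
  exact: measurable_funTS.
rewrite [RHS]integral_mkcond; apply: eq_integral => x _.
by rewrite patchE; case: ifPn => // /negP xD; apply: fD => Dx; apply/xD/mem_set.
Qed.

Lemma lebesgue_measure_sym_itv (R : realType) (c : R) : 0 <= c ->
  lebesgue_measure (`[- c, c]%classic : set R) = (2 * c)%:E.
Proof.
move=> c0; rewrite lebesgue_measure_itv /= lte_fin.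
case: ifPn => [_|]; first by rewrite -EFinB; congr EFin; ring.
by rewrite -leNgt => cN; congr EFin; lra.
Qed.

Lemma lebesgue_rV_cube (R : realType) n (c : R) : 0 <= c ->
  lebesgue_rV n [set v : 'rV[R]_n | forall i, `[- c, c]%classic (v ord0 i)] =
    ((2 * c) ^+ n)%:E.
Proof.
move=> c0; rewrite (@lebesgue_rV_box R n (fun=> `[- c, c]%classic))//.
under eq_bigr do rewrite lebesgue_measure_sym_itv//.
by rewrite prodEFin prodr_const card_ord.
Qed.

Definition set_coord (R : realType) n (k : 'I_n) (x : 'rV[R]_n) (t : R) : 'rV[R]_n :=
  \row_i (if i == k then t else x ord0 i).

Lemma set_coord_cons0 (R : realType) n (a t : R) (v : 'rV[R]_n) :
  set_coord ord0 (rV_cons (a, v)) t = rV_cons (t, v).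
Proof.
apply/rowP => i; rewrite mxE; have [j ->|->] := unliftP ord0 i.
  by rewrite !rV_consS.
by rewrite eqxx rV_cons0.
Qed.

Lemma set_coord_consS (R : realType) n (j : 'I_n) (a t : R) (v : 'rV[R]_n) :
  set_coord (lift ord0 j) (rV_cons (a, v)) t = rV_cons (a, set_coord j v t).
Proof.
apply/rowP => i; rewrite mxE; have [l ->|->] := unliftP ord0 i.
  by rewrite !rV_consS mxE (inj_eq (@lift_inj _ ord0)).
by rewrite !rV_cons0.
Qed.

(** Fubini: the direction of the sections is either the first one, or a
direction of the remaining space, to which the induction applies. *)
Lemma lebesgue_rV_slab (R : realType) n (k : 'I_n) (A : set 'rV[R]_n) (c r : R) :
  measurable A -> 0 <= c -> 0 <= r ->
  (forall x, A x -> forall i, `|x ord0 i| <= c) ->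
  (forall x, (lebesgue_measure [set t | A (set_coord k x t)] <= r%:E)%E) ->
  (lebesgue_rV n A <= (r * (2 * c) ^+ n.-1)%:E)%E.
Proof.
elim: n k A => [[]//|n IHn] k A mA c0 r0 Ac Ar.
pose B := @rV_cons R n @^-1` A.
have mB : measurable B.
  by have := @measurable_rV_cons _ R n measurableT _ mA; rewrite setTI.
have -> : lebesgue_rV n.+1 A = (@lebesgue_measure R \x @lebesgue_rV R n)%E B by [].
have [j kj|k0] := unliftP ord0 k.
  rewrite /product_measure1.
  have -> : r * (2 * c) ^+ n = r * (2 * c) ^+ n.-1 * (2 * c).
    by rewrite -mulrA -exprSr prednK// (leq_trans _ (ltn_ord j)).
  rewrite EFinM -lebesgue_measure_sym_itv//.
  apply: ge0_integral_le_cst => //.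
  - exact: measurable_fun_xsection.
  - by rewrite mulr_ge0// exprn_ge0// mulr_ge0.
  - move=> t tc; apply: (IHn j) => //.
    + exact: measurable_xsection.
    + by move=> v /xsectionP Av i; have := Ac _ Av (lift ord0 i); rewrite rV_consS.
    + move=> v; have := Ar (rV_cons (t, v)); apply: le_trans.
      rewrite le_eqVlt; apply/orP; left; apply/eqP; congr (lebesgue_measure _).
      apply/seteqP; split=> s; rewrite /= kj set_coord_consS.
        by move/xsectionP.
      by move=> h; apply/xsectionP.
  - move=> t tc; rewrite /= (_ : xsection B t = set0) ?measure0//.
    rewrite -subset0 => v /xsectionP Av; apply: tc => /=.
    by rewrite in_itv/= -ler_norml; have := Ac _ Av ord0; rewrite rV_cons0.
have -> : product_measure1 lebesgue_measure (@lebesgue_rV R n) B =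
    product_measure2 lebesgue_measure (@lebesgue_rV R n) B.
  have := @indic_fubini_tonelli _ _ _ _ R lebesgue_measure (@lebesgue_rV R n) B mB.
  by rewrite indic_fubini_tonelli_FE// indic_fubini_tonelli_GE.
rewrite EFinM -lebesgue_rV_cube//; apply: ge0_integral_le_cst => //.
- exact: (@measurable_box R n (fun=> `[- c, c]%classic)).
- exact: measurable_fun_ysection.
- move=> v vc; have := Ar (rV_cons (0, v)); apply: le_trans.
  rewrite le_eqVlt; apply/orP; left; apply/eqP; congr (lebesgue_measure _).
  by apply/seteqP; split=> t; rewrite ysectionE /= k0 set_coord_cons0.
- move=> v vc; rewrite /= (_ : ysection B v = set0) ?measure0//.
  rewrite -subset0 => t; rewrite ysectionE /= => Av; apply: vc => i /=.
  by rewrite in_itv/= -ler_norml; have := Ac _ Av (lift ord0 i); rewrite rV_consS.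
Qed.

Lemma lebesgue_interval_shell (R : realType) (S S' : set R) (rho : R) :
  0 <= rho -> has_ubound S -> has_lbound S ->
  (forall a b t, S a -> S b -> a <= t <= b -> S t) ->
  (forall t, S' t -> exists2 s, S s & `|t - s| <= rho) ->
  measurable (S' `\` S) ->
  (lebesgue_measure (S' `\` S) <= (2 * rho)%:E)%E.
Proof.
move=> rho0 ubS lbS itvS S'S mS.
have [->|/set0P[t0 /S'S[s0 Ss0 _]]] := eqVneq S' set0.
  by rewrite set0D measure0 lee_fin mulr_ge0.
have infS : has_inf S by split => //; exists s0.
have supS : has_sup S by split => //; exists s0.
pose lower : set R := `[inf S - rho, inf S]%classic.
pose upper : set R := `[sup S, sup S + rho]%classic.
have sub : S' `\` S `<=` lower `|` upper.
  move=> t [/S'S[s Ss]]; rewrite ler_distl => /andP[t1 t2] St.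
  have infs : inf S <= s by exact: ge_inf.
  have sups : s <= sup S by exact: ub_le_sup.
  have [ts|st] := leP t s.
    left; rewrite /lower/= in_itv/= (le_trans _ t1) ?lerB//= leNgt; apply/negP => it.
    have [s1 Ss1 /ltW s1t] := inf_lt infS.1 it.
    by apply: St; apply: (itvS s1 s) => //; rewrite s1t.
  right; rewrite /upper/= in_itv/= (le_trans t2) ?lerD// andbT leNgt; apply/negP => it.
  have [s1 Ss1 /ltW s1t] := sup_gt supS.1 it.
  apply: St; apply: (itvS s s1) => //.
  by rewrite s1t (ltW st).
have itvE (x y : R) : x <= y -> lebesgue_measure (`[x, y]%classic : set R) = (y - x)%:E.
  move=> xy; rewrite lebesgue_measure_itv /= lte_fin.
  case: ifPn => [_|]; first by rewrite -EFinB.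
  by rewrite -leNgt => yx; congr EFin; lra.
apply: (@le_trans _ _ (lebesgue_measure (lower `|` upper))).
  apply: le_measure => //; rewrite inE//.
  by apply: measurableU; exact: measurable_itv.
have -> : (2 * rho)%:E = (lebesgue_measure lower + lebesgue_measure upper)%E.
  by rewrite !itvE ?lerDl ?gerBl// -EFinD; congr EFin; ring.
by apply: measureU2; exact: measurable_itv.
Qed.

Section fatten.
Context {R : realType} {n : nat}.
Implicit Types (L : set 'rV[R]_n) (rho : R) (k : nat).

(** The intermediate sets between [L], for [k = 0], and its neighbourhood
[thicken L rho], for [k = n]. *)
Definition fatten L rho k : set 'rV[R]_n :=
  [set x | exists2 y, L y &
    forall i, `|(x - y) ord0 i| <= if (i < k)%N then rho else 0].

Definition thicken L rho : set 'rV[R]_n :=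
  [set x | exists2 y, L y & `|x - y| <= rho].

Lemma fatten0 L rho : fatten L rho 0 = L.
Proof.
apply/seteqP; split => [x [y Ly yx]|x Lx]; last first.
  by exists x => // i; rewrite subrr mxE normr0.
rewrite (_ : x = y)//; apply/eqP; rewrite -subr_eq0; apply/eqP/rowP => i.
by rewrite [RHS]mxE; apply/eqP; rewrite -normr_le0; exact: yx.
Qed.

Lemma fattenn L rho : 0 <= rho ->
  fatten L rho n = thicken L rho.
Proof.
move=> rho0; apply/seteqP; split => x [y Ly yx]; exists y => //.
  by apply: norm_le_coord => // i; have := yx i; rewrite ltn_ord.
by move=> i; rewrite ltn_ord (le_trans (coord_le_norm _ _)).
Qed.

Lemma compact_fatten L rho k : compact L -> compact (fatten L rho k).
Proof.
move=> cL; pose r (i : 'I_n) := if (i < k)%N then rho else 0.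
pose Q := [set v : 'rV[R]_n | forall i, `[- r i, r i]%classic (v ord0 i)].
have cQ : compact Q.
  by apply: (@rV_compact R n (fun i => `[- r i, r i]%classic)) => i; exact: segment_compact.
rewrite (_ : fatten L rho k = (fun z => z.1 + z.2) @` (L `*` Q)).
  apply: continuous_compact; last exact: compact_setX.
  exact/continuous_subspaceT/add_continuous.
apply/seteqP; split => [x [y Ly yx]|x [[y v]] /= [Ly Qv] <-].
  exists (y, x - y); last by rewrite /= addrC subrK.
  by split => // i /=; rewrite in_itv/= -ler_norml; exact: yx.
by exists y => // i; rewrite addrC addKr ler_norml; have := Qv i; rewrite /= in_itv.
Qed.

Lemma compact_thicken L rho : 0 <= rho -> compact L -> compact (thicken L rho).
Proof. by move=> rho0 cL; rewrite -fattenn//; exact: compact_fatten. Qed.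

Lemma convex_fatten L rho k : @convex_set R 'rV[R]_n L ->
  @convex_set R 'rV[R]_n (fatten L rho k).
Proof.
move=> /convexP vL; apply/convexP => x x' t t01 [y Ly yx] [y' Ly' yx'].
exists (t *: y + (1 - t) *: y'); first exact: vL.
move=> i; have := yx i; have := yx' i; rewrite !mxE => h h'.
have /andP[t0] := t01; rewrite -subr_ge0 => t1.
rewrite (_ : _ - _ = t * (x ord0 i - y ord0 i) + (1 - t) * (x' ord0 i - y' ord0 i));
  last by ring.
rewrite (le_trans (ler_normD _ _))// !normrM (ger0_norm t0) (ger0_norm t1).
have -> : (if (i < k)%N then rho else 0) = t * (if (i < k)%N then rho else 0) +
  (1 - t) * (if (i < k)%N then rho else 0) by ring.
by apply: lerD; rewrite ler_wpM2l.
Qed.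

Lemma compact_measurable_rV L : compact L -> measurable L.
Proof.
move=> cL; rewrite -[L]setCK; apply: measurableC; apply: open_measurable_rV.
by rewrite openC; apply: compact_closed cL; exact: norm_hausdorff.
Qed.

Lemma measurable_set_coord (k : 'I_n) x : measurable_fun [set: R] (set_coord k x).
Proof.
apply/measurable_fun_coordP => i; under eq_fun do rewrite mxE.
by case: eqP => _; [exact: measurable_id|exact: measurable_cst].
Qed.

(** When the set is thickened in one more direction, only the two ends of its
sections in this direction grow, by [rho] each. *)
Lemma lebesgue_rV_shell L rho c : compact L -> @convex_set R 'rV[R]_n L ->
  0 <= c -> (forall x, L x -> `|x| <= c) -> 0 <= rho ->
  (lebesgue_rV n (thicken L rho `\` L) <=
    (n%:R * (2 * rho * (2 * (c + rho)) ^+ n.-1))%:E)%E.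
Proof.
move=> cL vL c0 Lc rho0; rewrite -fattenn//.
suff : forall k, (k <= n)%N -> (lebesgue_rV n (fatten L rho k `\` L) <=
    (k%:R * (2 * rho * (2 * (c + rho)) ^+ n.-1))%:E)%E by exact.
have mF k : measurable (fatten L rho k) by exact: (compact_measurable_rV (@compact_fatten L rho k cL)).
have mL := compact_measurable_rV cL.
elim=> [_|k IHk kn]; first by rewrite fatten0 setDv measure0 mul0r.
apply: (@le_trans _ _ (lebesgue_rV n ((fatten L rho k.+1 `\` fatten L rho k) `|`
    (fatten L rho k `\` L)))).
  apply: le_measure; rewrite ?inE; [| |].
  - by apply: measurableD.
  - by apply: measurableU; apply: measurableD.
  - by move=> x [xk Lx]; have [?|?] := pselect (fatten L rho k x); [right|left].
apply: le_trans (measureU2 _ _ _) _.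
- exact: measurableD.
- by apply: measurableD.
rewrite -natr1 mulrDl mul1r EFinD addeC leeD ?IHk ?(ltnW kn)//.
pose i := Ordinal kn.
apply: (@lebesgue_rV_slab R n i).
- exact: measurableD.
- by rewrite addr_ge0.
- by rewrite mulr_ge0.
- move=> x [[y Ly yx] _] l.
  have -> : x ord0 l = y ord0 l + (x - y) ord0 l by rewrite !mxE; ring.
  apply: le_trans (ler_normD _ _) _; apply: lerD.
    exact: le_trans (coord_le_norm _ _) (Lc _ Ly).
  by apply: le_trans (yx l) _; case: ifP.
move=> x.
have mS : measurable [set t | (fatten L rho k.+1 `\` fatten L rho k) (set_coord i x t)].
  have := @measurable_set_coord i x measurableT (fatten L rho k.+1 `\` fatten L rho k).
  by rewrite setTI; apply; exact: measurableD.
have sectionc t : fatten L rho k (set_coord i x t) -> `|t| <= c.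
  move=> [y Ly /(_ i)]; rewrite ltnn normr_le0 !mxE eqxx subr_eq0 => /eqP ->.
  exact: le_trans (coord_le_norm _ _) (Lc _ Ly).
apply: (@lebesgue_interval_shell R [set t | fatten L rho k (set_coord i x t)]
    [set t | fatten L rho k.+1 (set_coord i x t)]) => //.
- by exists c => t /sectionc; rewrite ler_norml => /andP[].
- by exists (- c) => t /sectionc; rewrite ler_norml => /andP[].
- move=> a b t /= Fa Fb /andP[a_t t_b].
  have [ab|ab] := eqVneq a b.
    by rewrite (_ : t = a)//; apply/le_anti; rewrite a_t andbT ab.
  have ba : 0 < b - a by rewrite subr_gt0 lt_neqAle ab (le_trans a_t).
  have /convexP vF := @convex_fatten L rho k vL.
  have t01 : 0 <= (b - t) / (b - a) <= 1.
    by rewrite divr_ge0 ?(ltW ba) ?subr_ge0//= ler_pdivrMr// mul1r lerB.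
  have := vF _ _ _ t01 Fa Fb.
  rewrite (_ : _ + _ = set_coord i x t)//.
  by apply/rowP => l; rewrite !mxE; case: eqP => _; field; rewrite gt_eqF.
- move=> t [y Ly yx]; exists (y ord0 i).
    exists y => // l; rewrite !mxE; case: eqP => [->|/eqP li].
      by rewrite subrr normr0; case: ifP.
    have := yx l; rewrite !mxE (negbTE li) ltnS leq_eqVlt.
    by rewrite (_ : (nat_of_ord l == k) = false)//; apply/negbTE.
  by have := yx i; rewrite !mxE eqxx ltnSn.
Qed.
End fatten.

(** * Convex hulls of finitely many points *)

Lemma convex_comb_in (R : realType) d (C : set 'rV[R]_d) n (l : 'I_n -> R)
    (x : 'I_n -> 'rV[R]_d) :
  @convex_set R 'rV[R]_d C -> (forall i, 0 <= l i) -> \sum_i l i = 1 ->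
  (forall i, C (x i)) -> C (\sum_i l i *: x i).
Proof.
move=> /convexP vC; elim: n l x => [|n IHn] l x l0.
  by rewrite big_ord0 => /eqP; rewrite eq_sym oner_eq0.
rewrite !big_ord_recl => l1 Cx.
have [l01|l01] := eqVneq (l ord0) 1.
  have lE : \sum_(i < n) l (lift ord0 i) = 0 by move: l1; rewrite l01; lra.
  rewrite l01 scale1r big1 ?addr0// => i _.
  have -> : l (lift ord0 i) = 0.
    apply/eqP; move/eqP: lE; rewrite psumr_eq0// => /allP /(_ i).
    by rewrite mem_index_enum => /(_ isT).
  by rewrite scale0r.
have sE : \sum_(i < n) l (lift ord0 i) = 1 - l ord0 by rewrite -l1; ring.
have s0 : 0 < 1 - l ord0.
  by rewrite lt_neqAle -sE sumr_ge0// andbT eq_sym sE subr_eq0 eq_sym.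
rewrite (_ : \sum_(i < n) _ = (1 - l ord0) *:
    \sum_(i < n) (l (lift ord0 i) / (1 - l ord0)) *: x (lift ord0 i)).
  apply: vC => //; first by rewrite l0/= -subr_ge0 ltW.
  apply: IHn => // [i|]; first by rewrite divr_ge0// ltW.
  by rewrite -mulr_suml sE divff// gt_eqF.
rewrite scaler_sumr; apply: eq_bigr => i _.
by rewrite scalerA mulrC divfK// gt_eqF.
Qed.

Section hull.
Context {R : realType} {d n : nat}.
Implicit Types (x : 'I_n -> 'rV[R]_d) (l : 'rV[R]_n).

Let simplex : set 'rV[R]_n :=
  [set l | forall i, `[0, 1]%classic (l ord0 i)] `&` [set l | \sum_i l ord0 i = 1].

Let comb x l : 'rV[R]_d := \sum_i l ord0 i *: x i.

Lemma convex_set_hull (A : set 'rV[R]_d) : @convex_set R 'rV[R]_d (convex_hull A).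
Proof.
apply/convexP => a b t t01 Ha Hb C [vC AC].
by have /convexP := vC; apply => //; [apply: Ha|apply: Hb].
Qed.

Lemma convex_hull_comb x :
  convex_hull [set x i | i in [set: 'I_n]] = comb x @` simplex.
Proof.
apply/seteqP; split; last first.
  move=> _ [l [l01 l1] <-] C [vC xC]; apply: convex_comb_in => //.
    by move=> i; have := l01 i; rewrite /= in_itv/= => /andP[].
  by move=> i; apply: xC; exists i.
apply: smallest_sub.
  apply/convexP => _ _ t /andP[t0 t1] [l [l01 l1] <-] [l' [l01' l1'] <-].
  exists (t *: l + (1 - t) *: l'); last first.
    rewrite /comb !scaler_sumr -big_split /=; apply: eq_bigr => i _.
    by rewrite !scalerA -scalerDl !mxE.
  split => [i|] /=; last first.
    under eq_bigr do rewrite !mxE.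
    by rewrite big_split/= -!mulr_sumr l1 l1' !mulr1 subrKC.
  rewrite in_itv/= !mxE.
  have := l01 i; have := l01' i; rewrite /= !in_itv/= => /andP[a b] /andP[a' b'].
  rewrite addr_ge0 ?mulr_ge0 ?subr_ge0//=.
  rewrite -[leRHS](subrKC t) lerD// ler_piMr// subr_ge0//.
move=> _ [i _ <-]; exists (delta_mx ord0 i).
  split => [j|] /=; first by rewrite in_itv/= mxE eqxx/=; case: eqP => _ /=; rewrite ?lexx ?ler01.
  by rewrite (bigD1 i)//= big1 ?addr0 ?mxE ?eqxx// => j /negbTE ji; rewrite mxE ji andbF.
rewrite /comb (bigD1 i)//= big1 ?addr0 ?mxE ?eqxx ?scale1r// => j /negbTE ji.
by rewrite mxE ji andbF scale0r.
Qed.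

Lemma compact_convex_hull x : compact (convex_hull [set x i | i in [set: 'I_n]]).
Proof.
rewrite convex_hull_comb; apply: continuous_compact.
  apply: continuous_subspaceT.
  apply: (@continuous_big 'rV[R]_d) => [|i _ l]; first exact: add_continuous.
  apply: (@cvgZr_tmp R 'rV[R]_d _ _ (nbhs_filter l)).
  exact: coord_continuous.
have cQ : compact [set l : 'rV[R]_n | forall i, `[0, 1]%classic (l ord0 i)].
  by apply: (@rV_compact R n (fun=> `[0, 1]%classic)) => i; exact: segment_compact.
apply: compact_closedI => //.
apply: (@preimage_closed _ R^o (fun l : 'rV[R]_n => \sum_i l ord0 i) [set 1]).
  move=> l _; move: l.
  apply: (@continuous_big R^o) => [|i _ l]; first exact: add_continuous.
  exact: coord_continuous.
exact: closed_eq.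
Qed.

(** Strict separation, with a rational normal vector: there are only countably
many of these, which makes membership in the hull a measurable condition. *)
Lemma convex_hull_separation x (y : 'rV[R]_d) : (0 < n)%N ->
  ~ convex_hull [set x i | i in [set: 'I_n]] y <->
  exists q : 'rV[rat]_d, forall i, 0 < dotp (map_mx ratr q) (y - x i).
Proof.
move=> n0; split; last first.
  move=> [q qP] Hy.
  have : [set z | 0 < dotp (map_mx ratr q) (y - z)] y.
    apply: Hy; split; last by move=> _ [i _ <-]; exact: qP.
    apply/convexP => a b t /andP[t0 t1] /= a0 b0.
    rewrite (_ : y - _ = t *: (y - a) + (1 - t) *: (y - b)); last first.
      by rewrite !scalerBr addrACA -opprD -scalerDl subrKC scale1r.
    rewrite dotpDr !dotpZr.
    have [->|tn0] := eqVneq t 0; first by rewrite mul0r add0r subr0 mul1r.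
    rewrite ltr_pwDl ?mulr_gt0 ?mulr_ge0 ?subr_ge0 ?(ltW b0)//.
    by rewrite lt_neqAle eq_sym tn0.
  by rewrite /= subrr /dotp big1 ?ltxx// => i _; rewrite !mxE mulr0.
set H := convex_hull _ => Hy.
have cH : compact H by exact: compact_convex_hull.
have vH : @convex_set R 'rV[R]_d H by exact: convex_set_hull.
have xH i : H (x i) by apply: sub_gen_smallest; exists i.
have H0 : H !=set0 by exists (x (Ordinal n0)).
set p := nearest_point H y; pose u := y - p; pose delta := dotp u u.
have delta0 : 0 < delta.
  rewrite lt_neqAle dotp_ge0 andbT eq_sym; apply/eqP => u0; apply: Hy.
  rewrite (_ : y = p); first exact: nearest_point_in.
  by apply/eqP; rewrite -subr_eq0; apply/eqP/dotp_eq0; rewrite -/u -/delta u0.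
have ux i : delta <= dotp u (y - x i).
  have := nearest_point_angle cH vH H0 y (xH i); rewrite -/p -/u /delta.
  have -> : y - x i = u - (x i - p) by rewrite /u opprB addrA subrK.
  by rewrite dotpBr (dotpC (x i - p)); lra.
(* The nearest point gives the normal vector [u]; any vector within [e] of [u]
still separates, because [dotp u (y - x i)] is bounded below by [delta]. *)
pose B := 1 + \sum_i `|y - x i|.
have B0 : 0 < B by rewrite ltr_pwDl// sumr_ge0.
have xB i : `|y - x i| <= B.
  by rewrite /B (bigD1 i)//= addrCA lerDl addr_ge0// sumr_ge0.
pose e := delta / (2 * (d%:R + 1) * B).
have e0 : 0 < e by rewrite divr_gt0// !mulr_gt0// ltr_wpDl.
have /choice[q qP] i : exists q : rat, `|u ord0 i - ratr q| < e.
  have [|q] := @rat_in_itvoo R (u ord0 i - e) (u ord0 i + e).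
    by rewrite ltrBlDr -addrA ltrDl addr_gt0.
  by rewrite in_itv/= => /andP[q1 q2]; exists q; rewrite ltr_distlC q1.
exists (\row_i q i) => i.
set v := map_mx _ _; have := ux i.
have vE : dotp v (y - x i) = dotp u (y - x i) - dotp (u - v) (y - x i).
  by rewrite (dotpBl u v); ring.
suff : dotp (u - v) (y - x i) <= d%:R * (e * B).
  have : d%:R * (e * B) < delta.
    have dB : e * B = delta / (2 * (d%:R + 1)).
      rewrite /e; field; rewrite (gt_eqF B0)/= gt_eqF// ltr_wpDl//.
    rewrite dB mulrA ltr_pdivrMr ?mulr_gt0// ?ltr_wpDl//.
    have : 0 <= d%:R * delta by rewrite mulr_ge0// ltW.
    by move: delta0; lra.
  by rewrite vE; lra.
rewrite /dotp (le_trans (ler_norm _))// (le_trans (ler_norm_sum _ _ _))//.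
apply: (@le_trans _ _ (\sum_(j < d) e * B)); last first.
  by rewrite sumr_const card_ord mulr_natl.
apply: ler_sum => j _; rewrite normrM ler_pM//.
  rewrite (_ : (u - v) ord0 j = u ord0 j - ratr (q j)) ?ltW//.
  by rewrite [LHS]mxE; congr (_ + _); rewrite /v !mxE.
exact: le_trans (coord_le_norm _ _) (xB i).
Qed.

End hull.

(** * Measurability of the missing volume *)

(** An integral over a moving domain depends measurably on a parameter as soon as
the set of pairs (parameter, point of the domain) is measurable.  Here this
set is a countable union of finite intersections of measurable sets, by
[convex_hull_separation]. *)
Lemma measurable_missing_volume disp (T : measurableType disp) (R : realType) d n
    (X : 'I_n -> T -> 'rV[R]_d) (f : 'rV[R]_d -> R) (K : set 'rV[R]_d) :
  (0 < n)%N -> (forall i, measurable_fun setT (X i)) -> measurable K ->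
  measurable_fun setT f -> (forall x, 0 <= f x) ->
  measurable_fun setT
    (fun w => missing_volume f K (convex_hull [set X i w | i in [set: 'I_n]])).
Proof.
move=> n0 mX mK mf f0.
pose B : set (T * 'rV[R]_d) := [set z | exists q : 'rV[rat]_d,
  forall i, 0 < dotp (map_mx ratr q) (z.2 - X i z.1)].
have mB : measurable B.
  rewrite (_ : B = \bigcup_(q : 'rV[rat]_d) \bigcap_(i in [set` index_enum 'I_n])
      [set z | 0 < dotp (map_mx ratr q) (z.2 - X i z.1)]); last first.
    apply/seteqP; split => [z [q qP]|z [q _ qP]]; first by exists q => // i _; exact: qP.
    by exists q => i; apply: qP; rewrite /= mem_index_enum.
  apply: countable_bigcupT_measurable => [|q]; first exact: countableP.
  rewrite bigcap_seq; apply: bigsetI_measurable => i _.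
  have mg : measurable_fun setT
      (fun z : T * 'rV[R]_d => dotp (map_mx ratr q) (z.2 - X i z.1)).
    apply: measurable_sum => j; apply: measurable_funM; first exact: measurable_cst.
    under eq_fun do rewrite !mxE.
    apply: measurable_funB.
      exact: (measurableT_comp (@measurable_coord _ R d j) measurable_snd).
    exact: (measurableT_comp (@measurable_coord _ R d j)
      (measurableT_comp (mX i) (@measurable_fst _ _ T 'rV[R]_d))).
  have := mg measurableT `]0, +oo[%classic (measurable_itv _).
  rewrite setTI; congr measurable; apply/seteqP; split => z /=;
    by rewrite in_itv/= andbT.
pose h (z : T * 'rV[R]_d) : \bar R := (f z.2 * \1_(snd @^-1` K `&` B) z)%:E.
have mh : measurable_fun setT h.
  apply/measurable_EFinP; apply: measurable_funM.
    exact: (measurableT_comp mf measurable_snd).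
  apply: measurable_indic; apply: measurableI => //.
  by have := @measurable_snd _ _ T 'rV[R]_d measurableT K mK; rewrite setTI.
have h0 z : (0 <= h z)%E by rewrite lee_fin mulr_ge0.
have := measurable_fun_fubini_tonelli_F (m2 := @lebesgue_rV R d) h mh h0.
move/(measurableT_comp (fine_measurable measurableT)); congr measurable_fun.
apply/funext => w; rewrite /= /fubini_F /missing_volume /Rintegral; congr fine.
rewrite [RHS]integral_mkcond; apply: eq_integral => x _.
rewrite patchE /h indicE.
have -> : ((w, x) \in snd @^-1` K `&` B) =
    (x \in K `\` convex_hull [set X i w | i in [set: 'I_n]]).
  by apply/idP/idP => /set_mem [Kx Hx]; apply/mem_set; split => //;
    apply/(convex_hull_separation _ _ n0).
by case: ifPn => _; rewrite ?mulr1 ?mulr0.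
Qed.

(** * Concentration of the missing volume *)

Lemma measure_finite_union_le disp (T : measurableType disp) (R : realType)
    (mu : {measure set T -> \bar R}) (I : finType) (Q : pred I) (F : I -> set T)
    (r : R) :
  0 <= r -> (forall i, measurable (F i)) ->
  (forall i, Q i -> (mu (F i) <= r%:E)%E) ->
  measurable (\big[setU/set0]_(i | Q i) F i) /\
  (mu (\big[setU/set0]_(i | Q i) F i) <= (#|I|%:R * r)%:E)%E.
Proof.
move=> r0 mF Fr.
have [mU muU] : measurable (\big[setU/set0]_(i | Q i) F i) /\
    (mu (\big[setU/set0]_(i | Q i) F i) <= (\sum_(i | Q i) r)%:E)%E.
  elim/big_rec2 : _ => [|i y Y Qi [mY muY]]; first by rewrite measure0.
  split; first exact: measurableU.
  by rewrite (le_trans (measureU2 _ _ _))// EFinD leeD ?Fr.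
split => //; apply: le_trans muU _; rewrite lee_fin sumr_const mulr_natl.
by rewrite ler_wpMn2l// max_card.
Qed.

Section density.
Context {R : realType} {d : nat}.
Variables (f : 'rV[R]_d -> R) (M : R).
Hypotheses (df : probability_density f) (M0 : 0 < M)
  (fM : {ae lebesgue_rV d, forall x, f x <= M}).
Local Notation I A := (\int[lebesgue_rV d]_(x in A) (f x)%:E)%E.

Let mf : measurable_fun setT (EFin \o f).
Proof. by case: df => mf _ _; apply/measurable_EFinP. Qed.

Let f0 x : (0 <= (f x)%:E)%E.
Proof. by case: df => _ f0 _; rewrite lee_fin. Qed.

Lemma density_integral_ge0 A : (0 <= I A)%E.
Proof. exact: integral_ge0. Qed.

Lemma density_integral_le1 A : measurable A -> (I A <= 1)%E.
Proof.
case: df => _ _ <- mA; apply: ge0_subset_integral => //.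
Qed.

Lemma density_integral_fin_num A : measurable A -> I A \is a fin_num.
Proof.
move=> mA; rewrite ge0_fin_numE ?density_integral_ge0//.
by rewrite (le_lt_trans (density_integral_le1 mA))// ltry.
Qed.

(** What is missed by [H] is either missed by [G] or contained in the difference,
on which the density is bounded by [M]. *)
Lemma missing_volume_le K H G (v : R) : measurable K -> measurable H ->
  measurable G -> (lebesgue_rV d (G `\` H) <= v%:E)%E ->
  missing_volume f K H <= 1 - fine (I G) + M * v.
Proof.
move=> mK mH mG Gv.
have IGH : (I (G `\` H) <= (M * v)%:E)%E.
  apply: (@le_trans _ _ (\int[lebesgue_rV d]_(x in G `\` H) M%:E)%E).
    apply: ae_ge0_le_integral => //; [exact: measurableD|exact: measurable_funTS| | ].
      by move=> x _; rewrite lee_fin ltW.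
    by apply: filterS fM => x fxM _; rewrite lee_fin.
  rewrite integral_cst; last exact: measurableD.
  by rewrite EFinM lee_pmul2l// lte_fin.
have IK : (I (K `\` H) <= I (~` G) + I (G `\` H))%E.
  have disj : [disjoint ~` G & G `\` H] by apply/disj_setPS => x [nGx [Gx _]].
  rewrite -(ge0_integral_setU _ (measurableC mG) (measurableD mG mH) _ _ disj)//;
    last exact: measurable_funTS.
  apply: ge0_subset_integral => //; [exact: measurableD| |exact: measurable_funTS|].
    by apply: measurableU; [exact: measurableC|exact: measurableD].
  by move=> x [Kx Hx]; have [Gx|Gx] := pselect (G x); [right|left].
have IG : (I G + I (~` G) = 1)%E.
  have disj : [disjoint G & ~` G] by apply/disj_setPS => x [Gx nGx].
  rewrite -(ge0_integral_setU _ mG (measurableC mG) _ _ disj)//;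
    last exact: measurable_funTS.
  by rewrite setUv; case: df.
rewrite -lee_fin /missing_volume /Rintegral fineK; last first.
  by apply: density_integral_fin_num; exact: measurableD.
apply: (le_trans IK); rewrite EFinD leeD// EFinB fineK ?density_integral_fin_num//.
by rewrite -IG addeAC subee ?add0e// density_integral_fin_num.
Qed.

End density.

Lemma independent_all_in_le disp disp' (T : measurableType disp)
    (T' : measurableType disp') (R : realType)
    (P : probability T R) n (X : 'I_n -> {RV P >-> T'}) (G : set T') (eps : R) :
  mutually_independent P X -> measurable G ->
  (forall i, (P (X i @^-1` G) <= (1 - eps)%:E)%E) ->
  (P (\bigcap_(i in [set: 'I_n]) X i @^-1` G) <= (expR (- (n%:R * eps)))%:E)%E.
Proof.
move=> iX mG PG; have := iX [set: 'I_n]%SET (fun=> G) (fun=> mG).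
rewrite (_ : [set` [set: 'I_n]%SET] = [set: 'I_n]); last first.
  by apply/seteqP; split => i //= _; rewrite finset.in_setT.
move=> ->; rewrite -mulrN expRM_natl.
rewrite (_ : (_ ^+ n)%:E = \prod_(i in [set: 'I_n]%SET) (expR (- eps))%:E)%E; last first.
  by rewrite prodEFin prodr_const cardsT card_ord.
suff /andP[] : (0 <= \prod_(i in [set: 'I_n]%SET) P (X i @^-1` G) <=
    \prod_(i in [set: 'I_n]%SET) (expR (- eps))%:E)%E by [].
apply: (big_ind2 (fun a b => (0 <= a <= b)%E)) => [|a b a' b'|i _].
- by rewrite lexx lee01.
- move=> /andP[a0 ab] /andP[a0' ab']; rewrite mule_ge0//= lee_pmul//.
- rewrite measure_ge0/= (le_trans (PG i))// lee_fin.
  by have := expR_ge1Dx (- eps); lra.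
Qed.

(** The factor of [1 / m ^ 2] in the bound of [lebesgue_rV_shell] for subsets of
the unit cube and the radius [2 * (42 * d) / m ^ 2], twice the precision of the
net. *)
Definition shell_constant (R : realType) (d : nat) : R :=
  d%:R * (2 * (2 * (42 * d%:R)) * (2 * (1 + 2 * (42 * d%:R))) ^+ d.-1).

(** The union bound over the net.  The hull lies in the thickened representative
[G] of its class, which exceeds the hull only by a thin shell, so that a large
missing volume forces the probability of [G] to be small, although all the
points fell in [G]. *)
Lemma missing_volume_deviation (R : realType) (e n m : nat) (K : set 'rV[R]_e.+1)
    (f : 'rV[R]_e.+1 -> R) (M : R) disp (T : measurableType disp)
    (P : probability T R) (X : 'I_n -> {RV P >-> 'rV[R]_e.+1}) (eps : R) :
  (0 < n)%N -> (0 < m)%N -> measurable K -> (forall x, K x -> `|x| <= 1) ->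
  probability_density f -> (forall x, ~ K x -> f x = 0) -> 0 < M ->
  {ae lebesgue_rV e.+1, forall x, f x <= M} ->
  mutually_independent P X -> (forall i, has_density P (X i) f) ->
  (P [set w | (eps + M * (shell_constant R e.+1 / m%:R ^+ 2) <
        missing_volume f K (convex_hull [set X i w | i in [set: 'I_n]]))%R] <=
    (#|@signature_type e m|%:R * expR (- (n%:R * eps)))%:E)%E.
Proof.
move=> n0 m0 mK K1 df fK M0 fM iX dX.
have [mf f0 _] := df.
have mR : 1 <= m%:R :> R by rewrite ler1n.
pose mv w := missing_volume f K (convex_hull [set X i w | i in [set: 'I_n]]).
have mmv : measurable_fun setT mv.
  by apply: measurable_missing_volume => // i; exact: measurable_funP.
set E := [set w | _].
have mE : measurable E.
  have := mmv measurableT `]eps + M * (shell_constant R e.+1 / m%:R ^+ 2), +oo[%classic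
    (measurable_itv _).
  rewrite setTI; congr measurable; apply/seteqP; split => w /=;
    by rewrite in_itv/= andbT.
pose r : R := 42 * e.+1%:R / m%:R ^+ 2.
have r0 : 0 <= r by rewrite divr_ge0.
pose G t := thicken (@representative R e m t) r.
have mG t : measurable (G t).
  have [cL _ _ _] := @representativeP R e m t.
  exact: compact_measurable_rV (compact_thicken r0 cL).
have mX i A : measurable A -> measurable (X i @^-1` A).
  by move=> mA; rewrite -[X in measurable X]setTI; exact: measurable_funP.
pose Q t := fine (\int[lebesgue_rV e.+1]_(x in G t) (f x)%:E) <= 1 - eps.
(* The event [N] is negligible, and outside of it the event [E] implies [D]. *)
pose N := \big[setU/set0]_(i < n) (X i @^-1` (~` K)).
pose D := \big[setU/set0]_(t | Q t) \bigcap_(i in [set: 'I_n]) (X i @^-1` G t).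
have [mN PN] : measurable N /\ (P N <= (#|'I_n|%:R * 0)%:E)%E.
  apply: measure_finite_union_le => // i; first exact/mX/measurableC.
  move=> _; rewrite [leLHS](dX i _ (measurableC mK)).
  by rewrite integral0_eq// => x /fK ->.
have [mD PD] : measurable D /\
    (P D <= (#|@signature_type e m|%:R * expR (- (n%:R * eps)))%:E)%E.
  apply: measure_finite_union_le => [|t|t Qt]; first exact: expR_ge0.
    by apply: fin_bigcap_measurable => // i _; exact: mX.
  apply: independent_all_in_le => // i.
  by rewrite [leLHS](dX i _ (mG t)) -[leLHS]fineK ?lee_fin// density_integral_fin_num.
apply: (@le_trans _ _ (P (N `|` D))); last first.
  apply: le_trans (measureU2 _ mN mD) _; rewrite -[leRHS]add0e leeD//.
  by rewrite mulr0 in PN.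
apply: le_measure; rewrite ?inE//; first exact: measurableU.
move=> w Ew; have [Nw|Nw] := pselect (N w); [by left|right].
have XK i : K (X i w).
  by apply: contrapT => nK; apply: Nw; rewrite /N (bigD1 i)//=; left.
pose H := convex_hull [set X i w | i in [set: 'I_n]].
have XH i : H (X i w) by apply: sub_gen_smallest; exists i.
have cH : compact H by exact: compact_convex_hull.
have uH : unit_convex H.
  split => //; first exact: convex_set_hull.
    by exists (X (Ordinal n0) w); exact: XH.
  move=> x /(_ [set z | `|z| <= 1]); apply; split; last by move=> _ [i _ <-]; exact: K1.
  apply/convexP => a b s /andP[s0 s1] /= a1 b1.
  rewrite (le_trans (ler_normD _ _))// !normrZ !ger0_norm ?subr_ge0//.
  by rewrite -[leRHS](subrKC s) lerD// ler_piMr// subr_ge0.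
pose t := signature m H.
have uR := @representativeP R e m t.
have sE : signature m (@representative R e m t) = signature m H by exact: (@signature_representative R e m H uH).
have HG : H `<=` G t.
  by move=> x Hx; have [q Lq xq] := signature_close m0 uR uH sE Hx; exists q.
have GH : G t `<=` thicken H (2 * r).
  move=> x [y Ly yx]; have [q Hq yq] := signature_close m0 uH uR (esym sE) Ly.
  exists q => //; rewrite -[x - q](subrKA y) (le_trans (ler_normD _ _))//.
  by rewrite mulr_natl mulr2n lerD.
rewrite /D (bigD1 t)/=; last first.
  rewrite /Q.
  have : mv w <= 1 - fine (\int[lebesgue_rV e.+1]_(x in G t) (f x)%:E) +
      M * (shell_constant R e.+1 / m%:R ^+ 2).
    apply: missing_volume_le => //; first exact: compact_measurable_rV.
    have mH := compact_measurable_rV cH.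
    have r20 : 0 <= 2 * r by rewrite mulr_ge0.
    have mT := compact_measurable_rV (compact_thicken r20 cH).
    apply: (@le_trans _ _ (lebesgue_rV e.+1 (thicken H (2 * r) `\` H))).
      by apply: le_measure; rewrite ?inE; [exact: measurableD..|exact: setSD].
    have [_ vH _ H1] := uH.
    apply: le_trans (lebesgue_rV_shell cH vH ler01 H1 r20) _.
    have m2 : 1 <= m%:R ^+ 2 :> R by rewrite exprn_ege1.
    have rA : r <= 42 * e.+1%:R.
      by rewrite /r ler_pdivrMr ?(lt_le_trans ltr01)// ler_peMr// mulr_ge0.
    have rE : 42 * e.+1%:R = r * m%:R ^+ 2 by rewrite /r divfK// gt_eqF// (lt_le_trans ltr01).
    rewrite lee_fin /shell_constant [X in _ <= _ * (2 * (2 * X) * _) / _]rE /=.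
    rewrite [leRHS](_ : _ = e.+1%:R * (2 * (2 * r) *
        (2 * (1 + 2 * (42 * e.+1%:R))) ^+ e)); last first.
      by field; rewrite gt_eqF// (lt_le_trans ltr01).
    do 2 (rewrite ler_wpM2l ?mulr_ge0//).
    by rewrite lerXn2r ?nnegrE ?mulr_ge0 ?addr_ge0 ?mulr_ge0// ler_wpM2l// lerD2l ler_wpM2l.
  by move: Ew; rewrite /E/= -/(mv w); lra.
by left => i _; apply: HG; exact: XH.
Qed.

Lemma euclidean_unit_ball_norm (R : realType) d (x : 'rV[R]_d) :
  euclidean_unit_ball R d x -> `|x| <= 1.
Proof.
move=> x1; apply: norm_le_coord => // i; apply: le_trans x1.
rewrite -sqrtr_sqr; apply: ler_wsqrtr; rewrite (bigD1 i)//= lerDl.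
by apply: sumr_ge0 => j _; exact: sqr_ge0.
Qed.

(** The integer [m] is chosen so that the net of precision [1 / m ^ 2] is as
precise as the rate [b] in dimension [e.+1], while the logarithm of its
cardinality, a multiple of [m ^ e], is at most of order [n] times this rate. *)
Lemma exists_scale (R : realType) (e n : nat) : (0 < n)%N ->
  let b := n%:R `^ (- (2 / e.+2%:R)) : R in
  exists2 m, (0 < m)%N &
    (m%:R ^+ 2)^-1 <= b /\ m%:R ^+ e <= 2 ^+ e * (n%:R * b).
Proof.
move=> n0 b; pose a : R := n%:R `^ (e.+2%:R)^-1.
have a0 : 0 <= a by exact: powR_ge0.
have aE : a ^+ e.+2 = n%:R by rewrite -powR_mulrn// -powRrM mulVf// powRr1.
have a1 : 1 <= a.
  rewrite leNgt; apply/negP => a1.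
  by have : a ^+ e.+2 < 1; [rewrite exprn_ilt1|rewrite aE ltNge ler1n n0].
have bE : b = (a ^+ 2)^-1.
  by rewrite /b powRN mulrC powRrM -powR_mulrn.
exists (Num.truncn a).+1 => //.
have am : a <= (Num.truncn a).+1%:R by rewrite ltW// truncnS_gt.
have ma : (Num.truncn a).+1%:R <= 2 * a.
  by rewrite -natr1; have : (Num.truncn a)%:R <= a by [rewrite truncn_le]; lra.
split.
  rewrite bE lef_pV2 ?posrE ?exprn_gt0//; last by rewrite (lt_le_trans ltr01).
  by rewrite lerXn2r ?nnegrE.
have -> : n%:R * b = a ^+ e.
  rewrite bE -aE -addn2 exprD mulfK// expf_neq0// gt_eqF//.
  by rewrite (lt_le_trans ltr01).
by rewrite -exprMn lerXn2r ?nnegrE// mulr_ge0.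
Qed.

Theorem theorem1 (R : realType) (d : nat) (hd : (2 <= d)%N) :
  exists C1 C2 : R, [/\ 0 < C1, 0 < C2 &
    forall (n : nat) (K : set 'rV[R]_d) (f : 'rV[R]_d -> R) (M : R),
      (1 <= n)%N ->
      convex_body K -> K `<=` euclidean_unit_ball R d ->
      probability_density f -> (forall x, ~ K x -> f x = 0) ->
      0 < M -> {ae lebesgue_rV d, forall x, f x <= M} ->
    forall (disp : measure_display) (T : measurableType disp)
      (P : probability T R) (X : 'I_n -> {RV P >-> 'rV[R]_d}),
      mutually_independent P X -> (forall i, has_density P (X i) f) ->
    forall x : R, 0 <= x ->
      (P [set w | (x < n%:R *
            (missing_volume f K (convex_hull [set X i w | i in [set: 'I_n]])
             - C1 * (M + 1) * n%:R `^ (- (2 / d.+1%:R))))%R]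
       <= (C2 * expR (- x))%:E)%E].
Proof.
case: d hd => [//|e] e0.
have [c c0 cardP] : exists2 c : R, 0 <= c & forall m, (0 < m)%N ->
    #|@signature_type e m|%:R <= expR (c * m%:R ^+ e).
  by eexists; last (move=> m m0; exact: card_signature_type).
have V0 : 0 < shell_constant R e.+1.
  by rewrite !mulr_gt0// exprn_gt0// mulr_gt0// addr_gt0// !mulr_gt0.
set V := shell_constant R e.+1 in V0.
(* The term [V] pays for the volume of the shell, the other one for the
cardinality of the net. *)
exists (V + c * 2 ^+ e), 1; split => //.
  by rewrite ltr_pwDl// mulr_ge0// exprn_ge0.
move=> n K f M n0 [cK vK iK] KB df fK M0 fM disp T P X iX dX x x0.
have [m m0 []] := @exists_scale R e n n0.
set b := n%:R `^ _ => mb me.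
have nR : 0 < n%:R :> R by rewrite ltr0n.
(* With this value the events of the theorem and of the deviation bound agree. *)
pose eps := x / n%:R + (V + c * 2 ^+ e) * (M + 1) * b - M * (V / m%:R ^+ 2).
have := @missing_volume_deviation R e n m K f M disp T P X eps n0 m0
  (compact_measurable_rV cK) (fun z Kz => euclidean_unit_ball_norm (KB z Kz))
  df fK M0 fM iX dX.
set E := [set w | _]; set E' := [set w | _].
have -> : E = E'.
  by apply/seteqP; split => w; rewrite /E /E' /= [n%:R * _]mulrC -ltr_pdivrMr// /eps -/V; lra.
move=> /le_trans; apply; rewrite lee_fin mul1r.
apply: (@le_trans _ _ (expR (c * m%:R ^+ e) * expR (- (n%:R * eps)))).
  by rewrite ler_wpM2r ?expR_ge0 ?cardP.
rewrite -expRD ler_expR.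
have b0 : 0 <= b by exact: powR_ge0.
have epsE : c * 2 ^+ e * b <= eps - x / n%:R.
  rewrite /eps.
  have : M * (V / m%:R ^+ 2) <= M * V * b.
    by rewrite mulrA ler_wpM2l// mulr_ge0// ltW.
  have : 0 <= V * b by rewrite mulr_ge0// ltW.
  have : 0 <= M * (c * 2 ^+ e * b).
    by rewrite mulr_ge0 ?(ltW M0)// !mulr_ge0// exprn_ge0.
  lra.
have : n%:R * (c * 2 ^+ e * b) <= n%:R * (eps - x / n%:R) by rewrite ler_wpM2l// ltW.
have : c * m%:R ^+ e <= c * (2 ^+ e * (n%:R * b)) by rewrite ler_wpM2l.
have : n%:R * (x / n%:R) = x by rewrite mulrC divfK// gt_eqF.
by rewrite mulrBr; lra.
Qed.
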